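(* Let $\mathbf{k}$ be a field, and let $0\le a<b$, $0\le c<d$ be real numbers. (1) For $p\in(0,\infty)$, $$\mathbf{Ext}^1_{\ell^p_c}(\mathbf{k}[a,b),\mathbf{k}[c,d))\approx\mathbf{k}\Big[\max(0,c^p-b^p)^{\frac1p},\ \min\big(\max(0,c^p-a^p)^{\frac1p},\max(0,d^p-b^p)^{\frac1p}\big)\Big),$$ and $\mathbf{Ext}^i_{\ell^p_c}(\mathbf{k}[a,b),\mathbf{k}[c,d))=0$ for $i\ge 2$. (2) $\mathbf{Ext}^1_{\ell^\infty_c}(\mathbf{k}[a,b),\mathbf{k}[c,d))=\mathbf{k}[0,c)$ if $a<c\le b<d$, and $=0$ otherwise; and $\mathbf{Ext}^i_{\ell^\infty_c}(\mathbf{k}[a,b),\mathbf{k}[c,d))=0$ for $i\ge 2$. (3) For $p\in(0,\infty]$, $\mathbf{Ext}^i_{\ell^p_c}(\mathbf{k}[a,\infty),M)=0$ for any $i\ge 1$ and any persistence module $M:\mathbf{R}_+\to\mathbf{Vect}_{\mathbf{k}}$. (4) For $p\in(0,\infty]$, $\mathbf{Ext}^i_{\ell^p_c}(M,\mathbf{k}[0,d))=0$ for any $i\ge 1$ and any persistence module $M:\mathbf{R}_+\to\mathbf{Vect}_{\mathbf{k}}$.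
   Context: $\mathbb{R}_+=\{x\in\mathbb{R}:x\ge0\}$, viewed as a poset category $\mathbf{R}_+$. A persistence module is a functor $\mathbf{R}_+\to\mathbf{Vect}_{\mathbf{k}}$; they form an abelian category (exactness pointwise) with enough projectives and injectives. For an interval $A\subseteq\mathbb{R}_+$, $\mathbf{k}[A]$ equals $\mathbf{k}$ on $A$ and $0$ elsewhere, with identity maps inside $A$; $\mathbf{k}[a,b)$ means $\mathbf{k}[[a,b)]$, and $\mathbf{k}[x,y)=0$ if $x\ge y$. $\ell^p_c:\mathbb{R}_+^2\to\mathbb{R}_+$ is $\ell^p_c(x,y)=(x^p+y^p)^{1/p}$ for $p\in(0,\infty)$ and $\ell^\infty_c(x,y)=\max(x,y)$. With $\varphi=\ell^p_c$ and $\pi_1,\pi_2:\mathbb{R}_+^2\to\mathbb{R}_+$ the projections, the internal hom is $\mathscr{H}om^{\ell^p_c}(M,N)=\pi_{2*}\mathscr{H}om_{\mathbf{R}_+^2}(\pi_1^{-1}M,\varphi^{-1}N)$, where for order-preserving $h:P\to Q$, $(h^{-1}G)_p=G_{h(p)}$ and $(h_*F)_q=\lim_{q\le h(p)}F_p$, and for a poset $Q$, $\mathscr{H}om_{\mathbf{Q}}(M,N)_q$ is the vector space of natural transformations $M|_{\mathbf{U}_q}\to N|_{\mathbf{U}_q}$, $U_q=\{q'\in Q:q\le q'\}$, with restriction as structure maps. $\mathbf{Ext}^i_{\ell^p_c}$ denotes the $i$-th right derived functor of $\mathscr{H}om^{\ell^p_c}$: $\mathbf{Ext}^i_{\ell^p_c}(M,-)$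 is computed by applying $\mathscr{H}om^{\ell^p_c}(M,-)$ to an injective resolution of the second argument, and $\mathbf{Ext}^i_{\ell^p_c}(-,N)$ by applying $\mathscr{H}om^{\ell^p_c}(-,N)$ to a projective resolution of the first argument. *)

(* Defs.v *)
From HB Require Import structures.
From mathcomp Require Import all_boot all_order all_algebra.
From mathcomp Require Import mathcomp_extra boolp classical_sets reals.
From mathcomp Require Import constructive_ereal interval_inference exp.

Set Implicit Arguments.
Unset Strict Implicit.
Unset Printing Implicit Defensive.

Import Order.TTheory GRing.Theory Num.Theory.
Local Open Scope ring_scope.
Local Open Scope quotient_scope.

#[local] Obligation Tactic := idtac.

Section QuotientLmodule.
Variables (k : fieldType) (V : lmodType k) (W : submodClosed V).

(* The library does not infer closure under opposites from [submodClosed]. *)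
Definition sub_pred : {pred V} := W.
HB.instance Definition _ :=
  GRing.isSubmodClosed.Build k V sub_pred (GRing.subsemimodClosedP W).

Definition lquot := Quotient.quot sub_pred.
HB.instance Definition _ := GRing.Zmodule.on lquot.

Definition lproj (x : V) : lquot := \pi_(Quotient.quot sub_pred) x.
Definition lrepr (x : lquot) : V := repr x.

Lemma lreprK : cancel lrepr lproj.
Proof. exact: reprK. Qed.

Lemma lprojE x y : lproj x = lproj y <-> x - y \in W.
Proof.
rewrite /lproj; split => [/eqP|h]; last apply/eqP.
  by rewrite -Quotient.idealrBE.
by rewrite -Quotient.idealrBE.
Qed.

Lemma lprojD x y : lproj (x + y) = lproj x + lproj y.
Proof. exact: Quotient.pi_add. Qed.

Definition lscale (a : k) (x : lquot) : lquot := lproj (a *: lrepr x).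

Lemma lprojZ a x : lproj (a *: x) = lscale a (lproj x).
Proof.
apply/lprojE; rewrite -scalerBr; apply: rpredZ.
by apply/lprojE; rewrite lreprK.
Qed.

Lemma lscaleA a b x : lscale a (lscale b x) = lscale (a * b) x.
Proof. by rewrite -[x]lreprK -!lprojZ scalerA. Qed.
Lemma lscale1 : left_id 1 lscale.
Proof. by move=> x; rewrite -[x]lreprK -lprojZ scale1r. Qed.
Lemma lscaleDr : right_distributive lscale +%R.
Proof.
move=> a x y; rewrite -[x]lreprK -[y]lreprK.
by rewrite -lprojD -!lprojZ scalerDr lprojD.
Qed.
Lemma lscaleDl x : {morph lscale^~ x : a b / a + b}.
Proof. by move=> a b; rewrite -[x]lreprK -!lprojZ scalerDl lprojD. Qed.

HB.instance Definition _ := GRing.Zmodule_isLmodule.Build k lquot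
  lscaleA lscale1 lscaleDr lscaleDl.

Lemma lproj_linear : linear lproj.
Proof. by move=> a x y; rewrite lprojD lprojZ. Qed.
HB.instance Definition _ := GRing.isLinear.Build k V lquot _ lproj lproj_linear.

End QuotientLmodule.

(* A functor from the poset [Q] to vector spaces over [k]. *)
Record pmod (k : fieldType) d (Q : porderType d) := PMod {
  pm_obj :> Q -> lmodType k;
  pm_map : forall s t, (s <= t)%O -> {linear pm_obj s -> pm_obj t};
  pm_id : forall s (h : (s <= s)%O) x, pm_map h x = x;
  pm_comp : forall r s t (h : (r <= s)%O) (h' : (s <= t)%O) (h'' : (r <= t)%O) x,
    pm_map h'' x = pm_map h' (pm_map h x) }.

Lemma pm_map_irr (k : fieldType) d (Q : porderType d) (M : pmod k Q) s t
  (h h' : (s <= t)%O) x : pm_map M h x = pm_map M h' x.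
Proof. by rewrite (bool_irrelevance h h'). Qed.

Record phom (k : fieldType) d (Q : porderType d) (M N : pmod k Q) := PHom {
  ph_fun :> forall t, M t -> N t;
  ph_lin : forall t, linear (@ph_fun t);
  ph_nat : forall s t (h : (s <= t)%O) x,
    ph_fun (pm_map M h x) = pm_map N h (ph_fun x) }.

HB.instance Definition _ (k : fieldType) d (Q : porderType d) (M N : pmod k Q)
    (f : phom M N) (t : Q) :=
  GRing.isLinear.Build k (M t) (N t) _ (@ph_fun k d Q M N f t)
    (@ph_lin k d Q M N f t).

Section PHomLmodule.
Variables (k : fieldType) (d : Order.disp_t) (Q : porderType d).
Variables (M N : pmod k Q).

Lemma phom_ext (f g : phom M N) : (forall t x, f t x = g t x) -> f = g.
Proof.
case: f g => [f fl fn] [g gl gn] /= fg.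
have E : f = g by apply: functional_extensionality_dep => t; apply: funext => x.
by subst g; rewrite (Prop_irrelevance fl gl) (Prop_irrelevance fn gn).
Qed.

Program Definition phom_zero : phom M N := @PHom _ _ _ _ _ (fun t x => 0) _ _.
Next Obligation. by move=> t a x y; rewrite scaler0 addr0. Qed.
Next Obligation. by move=> s t h x; rewrite raddf0. Qed.

Program Definition phom_add (f g : phom M N) : phom M N :=
  @PHom _ _ _ _ _ (fun t x => f t x + g t x) _ _.
Next Obligation. by move=> f g t a x y; rewrite !linearP scalerDr addrACA. Qed.
Next Obligation. by move=> f g s t h x; rewrite /= !ph_nat raddfD. Qed.

Program Definition phom_opp (f : phom M N) : phom M N :=
  @PHom _ _ _ _ _ (fun t x => - f t x) _ _.
Next Obligation. by move=> f t a x y; rewrite [f t _]linearP opprD scalerN. Qed.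
Next Obligation. by move=> f s t h x; rewrite /= !ph_nat raddfN. Qed.

Program Definition phom_scale (c : k) (f : phom M N) : phom M N :=
  @PHom _ _ _ _ _ (fun t x => c *: f t x) _ _.
Next Obligation.
by move=> c f t a x y; rewrite [f t _]linearP scalerDr !scalerA mulrC.
Qed.
Next Obligation. by move=> c f s t h x; rewrite /= !ph_nat linearZ. Qed.

HB.instance Definition _ := gen_eqMixin (phom M N).
HB.instance Definition _ := gen_choiceMixin (phom M N).

Lemma phom_addA : associative phom_add.
Proof. by move=> f g h; apply: phom_ext => t x /=; rewrite addrA. Qed.
Lemma phom_addC : commutative phom_add.
Proof. by move=> f g; apply: phom_ext => t x /=; rewrite addrC. Qed.
Lemma phom_add0 : left_id phom_zero phom_add.
Proof. by move=> f; apply: phom_ext => t x /=; rewrite add0r. Qed.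
Lemma phom_addN : left_inverse phom_zero phom_opp phom_add.
Proof. by move=> f; apply: phom_ext => t x /=; rewrite addNr. Qed.

HB.instance Definition _ := GRing.isZmodule.Build (phom M N)
  phom_addA phom_addC phom_add0 phom_addN.

Lemma phom_scaleA a b f : phom_scale a (phom_scale b f) = phom_scale (a * b) f.
Proof. by apply: phom_ext => t x /=; rewrite scalerA. Qed.
Lemma phom_scale1 : left_id 1 phom_scale.
Proof. by move=> f; apply: phom_ext => t x /=; rewrite scale1r. Qed.
Lemma phom_scaleDr : right_distributive phom_scale +%R.
Proof. by move=> a f g; apply: phom_ext => t x /=; rewrite scalerDr. Qed.
Lemma phom_scaleDl f : {morph phom_scale^~ f : a b / a + b}.
Proof. by move=> a b; apply: phom_ext => t x /=; rewrite scalerDl. Qed.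

HB.instance Definition _ := GRing.Zmodule_isLmodule.Build k (phom M N)
  phom_scaleA phom_scale1 phom_scaleDr phom_scaleDl.

End PHomLmodule.

Program Definition phom_comp (k : fieldType) d (Q : porderType d)
    (M N L : pmod k Q) (g : phom N L) (f : phom M N) : phom M L :=
  @PHom _ _ _ _ _ (fun t x => g t (f t x)) _ _.
Next Obligation. by move=> *; move=> a x y; rewrite !linearP. Qed.
Next Obligation. by move=> *; rewrite /= !ph_nat. Qed.

(* Kernels and cokernels are pointwise, so monomorphisms, epimorphisms and
   exactness are the pointwise notions. *)
Definition pmono (k : fieldType) d (Q : porderType d) (M N : pmod k Q)
  (f : phom M N) : Prop := forall t, injective (f t).

Definition pepi (k : fieldType) d (Q : porderType d) (M N : pmod k Q)
  (f : phom M N) : Prop := forall t y, exists x, f t x = y.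

Definition pexact (k : fieldType) d (Q : porderType d) (L M N : pmod k Q)
    (f : phom L M) (g : phom M N) : Prop :=
  forall t y, g t y = 0 <-> exists x, f t x = y.

Definition piso (k : fieldType) d (Q : porderType d) (M N : pmod k Q) : Prop :=
  exists (f : phom M N) (g : phom N M),
    (forall t, cancel (f t) (g t)) /\ (forall t, cancel (g t) (f t)).

Program Definition pzero (k : fieldType) d (Q : porderType d) : pmod k Q :=
  @PMod k d Q (fun _ => 'rV[k]_0) (fun s t _ => idfun) _ _.
Next Obligation. by []. Qed.
Next Obligation. by []. Qed.

Section KerCoker.
Variables (k : fieldType) (d : Order.disp_t) (Q : porderType d).
Variables (M N : pmod k Q) (f : phom M N).

Definition in_ker (t : Q) : pred (M t) := fun x => f t x == 0.

Fact in_ker_submod t : submod_closed (@in_ker t).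
Proof.
split=> [|a x y]; rewrite -!topredE /= /in_ker; first exact/eqP/raddf0.
by move=> /eqP fx /eqP fy; rewrite linearP /= fx fy scaler0 addr0.
Qed.
HB.instance Definition _ t :=
  GRing.isSubmodClosed.Build k (M t) (@in_ker t) (@in_ker_submod t).

Definition ker_obj (t : Q) := {x : M t | in_ker x}.
HB.instance Definition _ t := SubType.copy (ker_obj t) {x : M t | in_ker x}.
HB.instance Definition _ t := [Choice of ker_obj t by <:].
HB.instance Definition _ t := [SubChoice_isSubLmodule of ker_obj t by <:].

Lemma ker_map_subproof s t (h : (s <= t)%O) (x : ker_obj s) :
  in_ker (pm_map M h (val x)).
Proof. by rewrite /in_ker ph_nat (eqP (valP x)) raddf0. Qed.
Definition ker_map s t (h : (s <= t)%O) (x : ker_obj s) : ker_obj t :=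
  Sub (pm_map M h (val x)) (ker_map_subproof h x).
Lemma ker_map_linear s t (h : (s <= t)%O) : linear (ker_map h).
Proof.
move=> a x y; apply: val_inj.
by rewrite linearP /=; exact: linearP.
Qed.
HB.instance Definition _ s t (h : (s <= t)%O) :=
  GRing.isLinear.Build k (ker_obj s) (ker_obj t) _ (ker_map h) (ker_map_linear h).

Program Definition pker : pmod k Q :=
  @PMod k d Q ker_obj (fun s t h => ker_map h) _ _.
Next Obligation. by move=> s h x; apply: val_inj; rewrite /= pm_id. Qed.
Next Obligation.
by move=> r s t h h' h'' x; apply: val_inj; rewrite /= (pm_comp h h').
Qed.

Definition in_im (t : Q) : pred (N t) := fun y => `[< exists x, f t x = y >].

Fact in_im_submod t : submod_closed (@in_im t).
Proof.
split=> [|a x y]; rewrite !unfold_in /in_im.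
  by apply/asboolP; exists 0; rewrite raddf0.
move=> /asboolP [u <-] /asboolP [v <-]; apply/asboolP.
by exists (a *: u + v); rewrite linearP.
Qed.
HB.instance Definition _ t :=
  GRing.isSubmodClosed.Build k (N t) (@in_im t) (@in_im_submod t).

Definition im_sub (t : Q) : submodClosed (N t) :=
  GRing.SubmodClosed.clone k (N t) (@in_im t) _.
Definition coker_obj (t : Q) : lmodType k := lquot (im_sub t).

Definition coker_map s t (h : (s <= t)%O) (x : coker_obj s) : coker_obj t :=
  lproj (im_sub t) (pm_map N h (lrepr x)).

Lemma coker_mapE s t (h : (s <= t)%O) (x : N s) :
  coker_map h (lproj (im_sub s) x) = lproj (im_sub t) (pm_map N h x).
Proof.
apply/lprojE; rewrite -raddfB.
have /lprojE /asboolP [u fu] := lreprK (lproj (im_sub s) x).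
by apply/asboolP; exists (pm_map M h u); rewrite ph_nat fu.
Qed.

Lemma coker_map_linear s t (h : (s <= t)%O) : linear (coker_map h).
Proof.
move=> a x y; rewrite -[x]lreprK -[y]lreprK.
by rewrite -linearP !coker_mapE -linearP -[in RHS]linearP.
Qed.
HB.instance Definition _ s t (h : (s <= t)%O) :=
  GRing.isLinear.Build k (coker_obj s) (coker_obj t) _ (coker_map h)
    (coker_map_linear h).

Program Definition pcoker : pmod k Q :=
  @PMod k d Q coker_obj (fun s t h => coker_map h) _ _.
Next Obligation. by move=> s h x; rewrite -[x]lreprK /= coker_mapE pm_id. Qed.
Next Obligation.
by move=> r s t h h' h'' x; rewrite -[x]lreprK /= !coker_mapE (pm_comp h h').
Qed.

End KerCoker.

Program Definition phom_id (k : fieldType) d (Q : porderType d) (M : pmod k Q) :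
  phom M M := @PHom _ _ _ _ _ (fun t x => x) _ _.
Next Obligation. by []. Qed.
Next Obligation. by []. Qed.

Definition subposet d (Q : porderType d) (P : pred Q) := {x : Q | P x}.
HB.instance Definition _ d (Q : porderType d) (P : pred Q) :=
  SubType.copy (subposet P) {x : Q | P x}.
HB.instance Definition _ d (Q : porderType d) (P : pred Q) :=
  [Choice of subposet P by <:].
HB.instance Definition _ d (Q : porderType d) (P : pred Q) :=
  [SubChoice_isSubPOrder of subposet P by <: with d].

Program Definition pullback (k : fieldType) d (P : porderType d) d'
    (Q : porderType d') (h : {omorphism P -> Q}) (G : pmod k Q) : pmod k P :=
  @PMod k d P (fun p => G (h p)) (fun p p' le_pp' => pm_map G (omorph_le h le_pp')) _ _.
Next Obligation. by move=> *; apply: pm_id. Qed.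
Next Obligation. by move=> *; apply: pm_comp. Qed.

Program Definition pullback_map (k : fieldType) d (P : porderType d) d'
    (Q : porderType d') (h : {omorphism P -> Q}) (G G' : pmod k Q)
    (f : phom G G') : phom (pullback h G) (pullback h G') :=
  @PHom _ _ _ _ _ (fun p x => f (h p) x) _ _.
Next Obligation. by move=> k d P d' Q h G G' f p; exact: (@ph_lin _ _ _ _ _ f (h p)). Qed.
Next Obligation. by move=> k d P d' Q h G G' f p p' pp' x; exact: (ph_nat f). Qed.

Definition subval d (Q : porderType d) (P : pred Q) :
  {omorphism subposet P -> Q} :=
  Order.OrderMorphism.clone d (subposet P) d Q val _.

Definition restr (k : fieldType) d (Q : porderType d) (P : pred Q)
  (M : pmod k Q) : pmod k (subposet P) := pullback (subval P) M.

(* The inclusion of [{x | P' x}] into [{x | P x}] when [P'] implies [P]. *)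
Definition subincl d (Q : porderType d) (P P' : pred Q) (PP : subpred P' P)
  (x : subposet P') : subposet P := exist _ (val x) (PP _ (valP x)).

Section Limit.
Variables (k : fieldType) (d : Order.disp_t) (P : porderType d).
Variable (F : pmod k P).

Record plim := PLim {
  lim_fun :> forall p, F p;
  lim_compat : forall p p' (h : (p <= p')%O), pm_map F h (lim_fun p) = lim_fun p' }.

Lemma plim_ext (x y : plim) : (forall p, x p = y p) -> x = y.
Proof.
case: x y => [x xc] [y yc] /= xy.
have E : x = y by apply: functional_extensionality_dep.
by subst y; rewrite (Prop_irrelevance xc yc).
Qed.

Program Definition plim_zero : plim := @PLim (fun p => 0) _.
Next Obligation. by move=> p p' h; rewrite raddf0. Qed.
Program Definition plim_add (x y : plim) : plim := @PLim (fun p => x p + y p) _.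
Next Obligation. by move=> x y p p' h; rewrite raddfD /= !lim_compat. Qed.
Program Definition plim_opp (x : plim) : plim := @PLim (fun p => - x p) _.
Next Obligation. by move=> x p p' h; rewrite raddfN /= !lim_compat. Qed.
Program Definition plim_scale (c : k) (x : plim) : plim :=
  @PLim (fun p => c *: x p) _.
Next Obligation. by move=> c x p p' h; rewrite linearZ /= !lim_compat. Qed.

HB.instance Definition _ := gen_eqMixin plim.
HB.instance Definition _ := gen_choiceMixin plim.

Lemma plim_addA : associative plim_add.
Proof. by move=> x y z; apply: plim_ext => p /=; rewrite addrA. Qed.
Lemma plim_addC : commutative plim_add.
Proof. by move=> x y; apply: plim_ext => p /=; rewrite addrC. Qed.
Lemma plim_add0 : left_id plim_zero plim_add.
Proof. by move=> x; apply: plim_ext => p /=; rewrite add0r. Qed.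
Lemma plim_addN : left_inverse plim_zero plim_opp plim_add.
Proof. by move=> x; apply: plim_ext => p /=; rewrite addNr. Qed.

HB.instance Definition _ := GRing.isZmodule.Build plim
  plim_addA plim_addC plim_add0 plim_addN.

Lemma plim_scaleA a b x : plim_scale a (plim_scale b x) = plim_scale (a * b) x.
Proof. by apply: plim_ext => p /=; rewrite scalerA. Qed.
Lemma plim_scale1 : left_id 1 plim_scale.
Proof. by move=> x; apply: plim_ext => p /=; rewrite scale1r. Qed.
Lemma plim_scaleDr : right_distributive plim_scale +%R.
Proof. by move=> a x y; apply: plim_ext => p /=; rewrite scalerDr. Qed.
Lemma plim_scaleDl x : {morph plim_scale^~ x : a b / a + b}.
Proof. by move=> a b; apply: plim_ext => p /=; rewrite scalerDl. Qed.

HB.instance Definition _ := GRing.Zmodule_isLmodule.Build k plim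
  plim_scaleA plim_scale1 plim_scaleDr plim_scaleDl.

End Limit.

Lemma plim_irr (k : fieldType) d (P : porderType d) (A : pred P) (F : pmod k P)
    (x : plim (restr A F)) p (hp hp' : A p) :
  lim_fun x (exist _ p hp) = lim_fun x (exist _ p hp') :> F p.
Proof. by rewrite (bool_irrelevance hp hp'). Qed.

Lemma phom_irr (k : fieldType) d (P : porderType d) (A : pred P)
    (M N : pmod k P) (f : phom (restr A M) (restr A N)) p (hp hp' : A p)
    (m : M p) :
  ph_fun f (t := exist _ p hp) m = ph_fun f (t := exist _ p hp') m :> N p.
Proof. by rewrite (bool_irrelevance hp hp'). Qed.

Section Pushforward.
Variables (k : fieldType) (d d' : Order.disp_t).
Variables (P : porderType d) (Q : porderType d') (h : {omorphism P -> Q}).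

Definition above (q : Q) : pred P := fun p => (q <= h p)%O.

Lemma above_sub q r : (q <= r)%O -> subpred (above r) (above q).
Proof. by move=> qr p; apply: le_trans. Qed.

(* The limit of [F] over the subposet of the [p] with [q <= h p]. *)
Definition push_obj (F : pmod k P) (q : Q) : lmodType k := plim (restr (above q) F).

Program Definition push_res (F : pmod k P) q r (qr : (q <= r)%O)
    (x : push_obj F q) : push_obj F r :=
  @PLim k d (subposet (above r)) (restr (above r) F)
    (fun p => lim_fun x (subincl (above_sub qr) p)) _.
Next Obligation.
move=> F q r qr x p p' pp'.
have le_pp' : (subincl (above_sub qr) p <= subincl (above_sub qr) p')%O.
  exact: pp'.
rewrite -(lim_compat x le_pp') /=; exact: (@pm_map_irr _ _ _ F).
Qed.

Lemma push_res_linear F q r (qr : (q <= r)%O) : linear (@push_res F q r qr).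
Proof. by move=> a x y; apply: plim_ext. Qed.
HB.instance Definition _ F q r (qr : (q <= r)%O) :=
  GRing.isLinear.Build k (push_obj F q) (push_obj F r) _ (@push_res F q r qr)
    (@push_res_linear F q r qr).

Program Definition pushforward (F : pmod k P) : pmod k Q :=
  @PMod k d' Q (push_obj F) (fun q r qr => @push_res F q r qr) _ _.
Next Obligation.
move=> F s ss x; apply: plim_ext => -[p hp] /=.
exact: plim_irr.
Qed.
Next Obligation.
move=> F r s t rs st rt x; apply: plim_ext => -[p hp] /=.
exact: plim_irr.
Qed.

End Pushforward.

Program Definition push_map (k : fieldType) d d' (P : porderType d)
    (Q : porderType d') (h : {omorphism P -> Q}) (F F' : pmod k P)
    (f : phom F F') : phom (pushforward h F) (pushforward h F') :=
  @PHom k d' Q (pushforward h F) (pushforward h F')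
    (fun q (x : push_obj h F q) =>
      @PLim k d (subposet (above h q)) (restr (above h q) F')
        (fun p => f (val p) (lim_fun x p)) _) _ _.
Next Obligation.
move=> k d d' P Q h F F' f q x p p' pp' /=.
by rewrite -(lim_compat x pp') -ph_nat.
Qed.
Next Obligation.
move=> k d d' P Q h F F' f q a x y; apply: plim_ext => p /=.
exact: linearP.
Qed.
Next Obligation.
by move=> k d d' P Q h F F' f q r qr x; apply: plim_ext.
Qed.

Section SheafHom.
Variables (k : fieldType) (d : Order.disp_t) (Q : porderType d).

Definition upset (q : Q) : pred Q := fun x => (q <= x)%O.

Lemma upset_sub q r : (q <= r)%O -> subpred (upset r) (upset q).
Proof. by move=> qr x; apply: le_trans. Qed.

(* Natural transformations between the restrictions to [U_q = upset q]. *)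
Definition shom_obj (M N : pmod k Q) (q : Q) : lmodType k :=
  phom (restr (upset q) M) (restr (upset q) N).

Program Definition shom_res (M N : pmod k Q) q r (qr : (q <= r)%O)
    (f : shom_obj M N q) : shom_obj M N r :=
  @PHom k d (subposet (upset r)) (restr (upset r) M) (restr (upset r) N)
    (fun x m => ph_fun f (t := subincl (upset_sub qr) x) m) _ _.
Next Obligation.
move=> M N q r qr f x.
exact: (@ph_lin _ _ _ _ _ f (subincl (upset_sub qr) x)).
Qed.
Next Obligation.
move=> M N q r qr f x x' xx' m.
have le_xx' : (subincl (upset_sub qr) x <= subincl (upset_sub qr) x')%O.
  exact: xx'.
have E := ph_nat f le_xx' m.
apply: etrans (etrans E _); last exact: (@pm_map_irr _ _ _ N).
by apply: (congr1 (@ph_fun _ _ _ _ _ f _)); exact: (@pm_map_irr _ _ _ M).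
Qed.

Lemma shom_res_linear M N q r (qr : (q <= r)%O) : linear (@shom_res M N q r qr).
Proof. by move=> a f g; apply: phom_ext. Qed.
HB.instance Definition _ M N q r (qr : (q <= r)%O) :=
  GRing.isLinear.Build k (shom_obj M N q) (shom_obj M N r) _
    (@shom_res M N q r qr) (@shom_res_linear M N q r qr).

Program Definition shom (M N : pmod k Q) : pmod k Q :=
  @PMod k d Q (shom_obj M N) (fun q r qr => @shom_res M N q r qr) _ _.
Next Obligation.
move=> M N s ss f; apply: phom_ext => -[x hx] m /=.
exact: phom_irr.
Qed.
Next Obligation.
move=> M N r s t rs st rt f; apply: phom_ext => -[x hx] m /=.
exact: phom_irr.
Qed.

Program Definition shom_map (M M' N N' : pmod k Q) (f : phom M' M) (g : phom N N') :
    phom (shom M N) (shom M' N') :=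
  @PHom k d Q (shom M N) (shom M' N')
    (fun q (u : shom_obj M N q) =>
       phom_comp (pullback_map (subval (upset q)) g)
         (phom_comp u (pullback_map (subval (upset q)) f))) _ _.
Next Obligation.
move=> M M' N N' f g q a u v; apply: phom_ext => x m /=.
exact: linearP.
Qed.
Next Obligation.
by move=> M M' N N' f g q r qr u; apply: phom_ext.
Qed.

End SheafHom.

Section InternalHom.
Variables (k : fieldType) (d : Order.disp_t) (Q : porderType d).
Variable phi : {omorphism (Q *p Q)%type -> Q}.

Definition pr1 (z : (Q *p Q)%type) : Q := z.1.
Definition pr2 (z : (Q *p Q)%type) : Q := z.2.
Fact pr1_homo : {homo pr1 : x y / (x <= y)%O}.
Proof. by move=> x y /andP[]. Qed.
Fact pr2_homo : {homo pr2 : x y / (x <= y)%O}.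
Proof. by move=> x y /andP[]. Qed.
HB.instance Definition _ := Order.isOrderMorphism.Build _ _ _ _ pr1 pr1_homo.
HB.instance Definition _ := Order.isOrderMorphism.Build _ _ _ _ pr2 pr2_homo.

(* [pi_{2*} Hom_{Q x Q}(pi_1^{-1} M, phi^{-1} N)], where [Q x Q] carries the
   product order. *)
Definition ihom (M N : pmod k Q) : pmod k Q :=
  pushforward pr2 (shom (pullback pr1 M) (pullback phi N)).

Definition ihom_map (M M' N N' : pmod k Q) (f : phom M' M) (g : phom N N') :
    phom (ihom M N) (ihom M' N') :=
  push_map pr2 (shom_map (pullback_map pr1 f) (pullback_map phi g)).

Record cochain := Cochain {
  cc_obj :> nat -> pmod k Q;
  cc_d : forall i, phom (cc_obj i) (cc_obj i.+1);
  cc_dd : forall i t x, cc_d i.+1 t (cc_d i t x) = 0 }.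

Program Definition to_cocycle (C : cochain) i : phom (C i) (pker (cc_d C i.+1)) :=
  @PHom k d Q (C i) (pker (cc_d C i.+1))
    (fun t x => exist _ (cc_d C i t x) _) _ _.
Next Obligation. by move=> C i t x; apply/eqP/cc_dd. Qed.
Next Obligation. by move=> C i t a x y; apply: val_inj; exact: linearP. Qed.
Next Obligation. by move=> C i s t h x; apply: val_inj; exact: ph_nat. Qed.

Definition cohomology (C : cochain) (i : nat) : pmod k Q :=
  match i with
  | 0 => pker (cc_d C 0)
  | j.+1 => pcoker (to_cocycle C j)
  end.

Definition pinjective (I : pmod k Q) : Prop :=
  forall (A B : pmod k Q) (f : phom A B) (g : phom A I), pmono f ->
  exists h : phom B I, forall t x, h t (f t x) = g t x.

Definition pprojective (P : pmod k Q) : Prop :=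
  forall (A B : pmod k Q) (f : phom A B) (g : phom P B), pepi f ->
  exists h : phom P A, forall t x, f t (h t x) = g t x.

Record inj_resolution (N : pmod k Q) := InjResolution {
  ir_obj :> nat -> pmod k Q;
  ir_d : forall i, phom (ir_obj i) (ir_obj i.+1);
  ir_aug : phom N (ir_obj 0);
  ir_injective : forall i, pinjective (ir_obj i);
  ir_aug_mono : pmono ir_aug;
  ir_aug_exact : pexact ir_aug (ir_d 0);
  ir_exact : forall i, pexact (ir_d i) (ir_d i.+1) }.

Record proj_resolution (M : pmod k Q) := ProjResolution {
  pr_obj :> nat -> pmod k Q;
  pr_d : forall i, phom (pr_obj i.+1) (pr_obj i);
  pr_aug : phom (pr_obj 0) M;
  pr_projective : forall i, pprojective (pr_obj i);
  pr_aug_epi : pepi pr_aug;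
  pr_aug_exact : pexact (pr_d 0) pr_aug;
  pr_exact : forall i, pexact (pr_d i.+1) (pr_d i) }.

Program Definition ihom_inj (M N : pmod k Q) (I : inj_resolution N) : cochain :=
  @Cochain (fun i => ihom M (I i)) (fun i => ihom_map (phom_id M) (ir_d I i)) _.
Next Obligation.
move=> M N I i t x; apply: plim_ext => p; apply: phom_ext => y m /=.
by apply/ir_exact; eexists.
Qed.

Program Definition ihom_proj (M N : pmod k Q) (P : proj_resolution M) : cochain :=
  @Cochain (fun i => ihom (P i) N) (fun i => ihom_map (pr_d P i) (phom_id N)) _.
Next Obligation.
move=> M N P i t x; apply: plim_ext => p; apply: phom_ext => y m /=.
have -> : pr_d P i _ (pr_d P i.+1 _ m) = 0 by apply/pr_exact; eexists.
exact: (raddf0 (ph_fun (lim_fun x p) (t := y))).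
Qed.

(* [is_ext i M N E]: [E] is isomorphic to the value at [(M, N)] of the [i]-th
   right derived functor of [ihom], whether computed from an injective
   resolution of [N] or from a projective resolution of [M]. Resolutions are
   required to exist, so that the universal quantifiers are not vacuous. *)
Definition is_ext (i : nat) (M N E : pmod k Q) : Prop :=
  [/\ inhabited (inj_resolution N),
      forall I : inj_resolution N, piso (cohomology (ihom_inj M I) i) E,
      inhabited (proj_resolution M) &
      forall P : proj_resolution M, piso (cohomology (ihom_proj N P) i) E].

End InternalHom.

Section IntervalModule.
Variables (k : fieldType) (R : realType).

Definition kfib (b : bool) : lmodType k := 
  if b then k^o : lmodType k else 'rV[k]_0 : lmodType k.

Definition kfib_map (b b' : bool) : kfib b -> kfib b' :=
  match b, b' return kfib b -> kfib b' with
  | true, true => idfun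
  | _, _ => fun _ => 0
  end.

Lemma kfib_map_linear b b' : linear (@kfib_map b b').
Proof. by case: b; case: b' => a x y //=; rewrite scaler0 addr0. Qed.
HB.instance Definition _ b b' :=
  GRing.isLinear.Build k (kfib b) (kfib b') _ (@kfib_map b b')
    (@kfib_map_linear b b').

(* The module k[A]; the bounds of [A] are reals and only its nonnegative
   elements matter. *)
Program Definition kint (A : interval R) : pmod k {nonneg R} :=
  @PMod k _ {nonneg R} (fun t => kfib (t%:num \in A))
    (fun s t _ => @kfib_map (s%:num \in A) (t%:num \in A)) _ _.
Next Obligation.
move=> A s h /=; case: (_ \in A) => //= x.
by apply/rowP => -[].
Qed.
Next Obligation.
move=> A r s t rs st rt.
have : r%:num \in A -> t%:num \in A -> s%:num \in A.
  clear rt; case: A => l u; rewrite !itv_boundlr => /andP[lr _] /andP[_ tu].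
  apply/andP; split; first by apply: le_trans lr _; rewrite bnd_simp.
  by apply: le_trans tu; rewrite bnd_simp.
move=> conv x; move: x conv => /=.
by case: (_ \in A); case: (_ \in A); case: (_ \in A) => //= x /(_ isT isT).
Qed.

End IntervalModule.

Section Cost.
Variable R : realType.

(* Only used for [0 < p]; the wildcard branch is the case [p = +oo]. *)
Definition lp_fun (p : \bar R) (z : {nonneg R} * {nonneg R}) : {nonneg R} :=
  match p with
  | q%:E => ((z.1%:num `^ q + z.2%:num `^ q) `^ q^-1)%:nng
  | _ => Order.max z.1 z.2
  end.

Definition lp (p : \bar R) (p_gt0 : (0 < p)%E)
  (z : ({nonneg R} *p {nonneg R})%type) : {nonneg R} := lp_fun p z.

Fact lp_homo p (p_gt0 : (0 < p)%E) : {homo lp p_gt0 : x y / (x <= y)%O}.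
Proof.
move=> [x1 x2] [y1 y2] /andP[/= le1 le2]; rewrite /lp /lp_fun.
case: p p_gt0 => [q|_|//].
  rewrite lte_fin => q_gt0.
  have q_ge0 := ltW q_gt0.
  change ((x1%:num `^ q + x2%:num `^ q) `^ q^-1
          <= (y1%:num `^ q + y2%:num `^ q) `^ q^-1).
  apply: ge0_ler_powR; rewrite ?invr_ge0 ?nnegrE ?addr_ge0 ?powR_ge0 //.
  by apply: lerD; apply: ge0_ler_powR; rewrite ?nnegrE.
by rewrite ge_max !le_max le1 le2 orbT.
Qed.
HB.instance Definition _ p (p_gt0 : (0 < p)%E) :=
  Order.isOrderMorphism.Build _ _ _ _ (lp p_gt0) (lp_homo p_gt0).

Definition lp_cost (p : \bar R) (p_gt0 : (0 < p)%E) :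
  {omorphism ({nonneg R} *p {nonneg R})%type -> {nonneg R}} := lp p_gt0.

End Cost.

(* Main.v *)
Require Import Defs.
From HB Require Import structures.
From mathcomp Require Import all_boot all_order all_algebra.
From mathcomp Require Import mathcomp_extra boolp classical_sets functions reals.
From mathcomp Require Import constructive_ereal interval_inference exp.

Set Implicit Arguments.
Unset Strict Implicit.
Unset Printing Implicit Defensive.

Import Order.TTheory GRing.Theory Num.Theory.
Local Open Scope ring_scope.

#[local] Obligation Tactic := idtac.

(** Evaluating at [t], the internal hom of [M] and [N] is the space of
morphisms from [M] to the pullback of [N] along the slice
[x |-> phi (x, t)] of the cost function ([ev_inj], [ev_surj]). So the stalk
at [t] of the derived functors is an ordinary Ext between persistence modules,
and everything rests on three facts.

Injectivity is a flabbiness condition. A module [I] is injective exactly when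
every compatible family of elements of [I] over an up-set [J] extends to any
lower bound of [J]: this is Baer's criterion, the up-sets being the submodules
of a free module on one generator ([flabby_injective],
[injective_flabby]). Flabbiness passes to pullbacks along monotone maps out of
a total order ([flabby_pullback]), so the slices of an injective module are
injective.

Ext is balanced. For a projective resolution [P] of [M] and an injective
resolution [I] of [N] the double complex of the internal homs from [P p] to
[I q] has exact rows (by flabbiness of the slices) and exact columns (by
projectivity), so its two edges have the same cohomology ([balance],
[ext_balance]). With enough injectives and projectives, one convenient
resolution of one argument then computes Ext for all resolutions of both
([is_ext_of_proj], [is_ext_of_inj]).

Convenient resolutions exist in all the cases. The module of [a, oo[ is
projective, being free on one generator, and that of [0, d[ is flabby, so
each is its own resolution and the higher Ext groups vanish. The module of
[a, b[ is the quotient of that of [a, oo[ by that of [b, oo[. Hence its Ext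
groups vanish from degree 2 on, and at [t] its Ext in degree 1 with values in
[N] is the cokernel of the map from [N] at [phi (a, t)] to [N] at
[phi (b, t)]. For [N] the module of [c, d[ this cokernel is nonzero exactly
when [phi (b, t)] lies in [c, d[ and [phi (a, t)] does not
([cohomology_interval1]); solving these inequalities for [t] gives the
interval of the statement, for each cost function. *)

(** * Morphisms given by their graphs *)

Section Relations.
Variables (k : fieldType) (d : Order.disp_t) (Q : porderType d).
Implicit Types X Y : pmod k Q.

(** Natural additive relations between two modules. Many morphisms below
(extensions, factorizations, maps out of a quotient) are easier to give by
their graph than by a formula that depends on choices. *)
Record subgraph X Y (G : forall t, X t -> Y t -> Prop) : Prop := Subgraph {
  sg0 : forall t, G t 0 0;
  sgP : forall t c x y x' y', G t x y -> G t x' y' -> G t (c *: x + x') (c *: y + y');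
  sg_nat : forall s t (h : (s <= t)%O) x y, G s x y ->
    G t (pm_map X h x) (pm_map Y h y) }.

(** For an additive relation, having at most one value at every argument
amounts to having only the value 0 at 0. *)
Definition univalent X Y (G : forall t, X t -> Y t -> Prop) :=
  forall t y, G t 0 y -> y = 0.

Lemma univalentP X Y (G : forall t, X t -> Y t -> Prop) t x y y' :
  subgraph G -> univalent G -> G t x y -> G t x y' -> y = y'.
Proof.
move=> sG uG Gy Gy'; apply/eqP; rewrite -subr_eq0; apply/eqP/(uG t).
have := sgP sG (-1) Gy' Gy.
by rewrite !scaleN1r addNr addrC.
Qed.

Lemma phom_of_graph X Y (G : forall t, X t -> Y t -> Prop) :
  subgraph G -> univalent G -> (forall t x, exists y, G t x y) ->
  exists f : phom X Y, forall t x, G t x (f t x).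
Proof.
move=> sG uG tG.
pose f t x := projT1 (cid (tG t x)).
have fP t x : G t x (f t x) by rewrite /f; case: cid.
have flin t : linear (f t).
  by move=> a x y; apply: (univalentP sG uG (fP _ _)); apply: (sgP sG); exact: fP.
have fnat s t (h : (s <= t)%O) x : f t (pm_map X h x) = pm_map Y h (f s x).
  by apply: (univalentP sG uG (fP _ _)); apply: (sg_nat sG); exact: fP.
by exists (PHom flin fnat).
Qed.

Lemma piso_of_graph X Y (G : forall t, X t -> Y t -> Prop) :
  subgraph G -> univalent G -> (forall t x, G t x 0 -> x = 0) ->
  (forall t x, exists y, G t x y) -> (forall t y, exists x, G t x y) -> piso X Y.
Proof.
move=> sG uG vG tG rG.
pose H t y x := G t x y.
have sH : subgraph H.
  split=> [t|t c x y x' y'|s t h x y]; [exact: (sg0 sG)|exact: (sgP sG)|].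
  exact: (sg_nat sG).
have [f fP] := phom_of_graph sG uG tG.
have [g gP] := @phom_of_graph _ _ H sH vG rG.
exists f, g; split=> t x.
  exact: (univalentP sH vG (gP _ _) (fP _ _)).
exact: (univalentP sG uG (fP _ _) (gP _ _)).
Qed.

Lemma piso_sym X Y : piso X Y -> piso Y X.
Proof. by case=> f [g [fg gf]]; exists g, f. Qed.

Lemma piso_trans X Y Z : piso X Y -> @piso k d Q Y Z -> piso X Z.
Proof.
case=> f [g [fg gf]] [f' [g' [fg' gf']]].
exists (phom_comp f' f), (phom_comp g g').
by split=> t x /=; rewrite ?fg' ?fg ?gf ?gf'.
Qed.

Lemma piso_pzero X : (forall t (x : X t), x = 0) -> piso X (pzero k Q).
Proof.
move=> X0; apply: (@piso_of_graph _ (pzero k Q) (fun _ _ _ => True)) => //.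
- by move=> t y _; apply/rowP => -[].
- by move=> t x; exists 0.
- by move=> t x; exists 0.
Qed.

End Relations.

(** * Flabby modules and Baer's criterion *)

Section Flabby.
Variables (k : fieldType) (d : Order.disp_t) (Q : porderType d).
Implicit Types M I : pmod k Q.

(** The transition map, extended by 0 to the pairs that are not ordered. It
needs no proof of [s <= t], so it can be used in sums and in case analyses. *)
Definition ptr M s t : M s -> M t :=
  if pselect (s <= t)%O is left h then pm_map M h else fun _ => 0.

Lemma ptrE M s t (h : (s <= t)%O) x : ptr t x = pm_map M h x.
Proof. by rewrite /ptr; case: pselect => // h'; apply: pm_map_irr. Qed.

Lemma ptr_eq0 M s t (x : M s) : ~ (s <= t)%O -> ptr t x = 0.
Proof. by rewrite /ptr; case: pselect. Qed.

Lemma ptr_id M s (x : M s) : ptr s x = x.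
Proof. by rewrite (ptrE (lexx s)) pm_id. Qed.

Lemma pm_map_ptr M r s t (h : (s <= t)%O) (x : M r) :
  (r <= s)%O -> pm_map M h (ptr s x) = ptr t x.
Proof.
move=> rs; rewrite (ptrE rs) (ptrE (le_trans rs h)).
by rewrite (pm_comp rs h).
Qed.

Lemma ptr_linear M s t : linear (@ptr M s t).
Proof.
move=> c x y; have [h|h] := pselect (s <= t)%O.
  by rewrite !(ptrE h) linearP.
by rewrite !ptr_eq0 // scaler0 addr0.
Qed.
HB.instance Definition _ M s t :=
  GRing.isLinear.Build k (M s) (M t) _ (@ptr M s t) (@ptr_linear M s t).

Lemma ph_ptr M N (f : phom M N) s t x : f t (ptr t x) = @ptr N s t (f s x).
Proof.
have [h|h] := pselect (s <= t)%O; first by rewrite !(ptrE h) ph_nat.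
by rewrite !ptr_eq0 // raddf0.
Qed.

(** Baer's condition: a compatible family over an up-set [J] is a morphism to
[I] from a submodule of the free module on one generator at [s]. In terms of
sheaves on the space whose open sets are the up-sets, it says that sections
extend, hence the name. *)
Definition flabby I := forall (J : Q -> Prop) (s : Q) (y : forall t, I t),
  (forall t u, (t <= u)%O -> J t -> J u) -> (forall t, J t -> (s <= t)%O) ->
  (forall t u (h : (t <= u)%O), J t -> pm_map I h (y t) = y u) ->
  exists z : I s, forall t (h : (s <= t)%O), J t -> pm_map I h z = y t.

Lemma ph0 M N (f : phom M N) t : f t 0 = 0.
Proof. exact: raddf0. Qed.

Lemma pexact_mono L M N P (f : phom L M) (g : phom M N) (j : @phom k d Q N P) :
  pexact f g -> pmono j -> pexact f (phom_comp j g).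
Proof.
move=> ex mj t y; rewrite -(ex t y) /=; split=> [|->]; last exact: ph0.
by rewrite -[X in _ = X -> _](ph0 j t) => /mj.
Qed.

Lemma pexact_epi K L M N (e : phom K L) (f : phom L M) (g : @phom k d Q M N) :
  pepi e -> pexact f g -> pexact (phom_comp f e) g.
Proof.
move=> ee ex t y; rewrite (ex t y); split=> [[x <-]|[x <-]]; last by exists (e t x).
by have [z <-] := ee t x; exists z.
Qed.

Section Extension.
Variables (B I : pmod k Q).
Hypothesis flI : flabby I.

(** The partial morphism [G] enlarged by sending [b] to [z]. *)
Definition adjoin (G : forall t, B t -> I t -> Prop) s (b : B s) (z : I s) t
    (x : B t) (y : I t) : Prop :=
  exists c x' y', [/\ G t x' y', x = c *: ptr t b + x' & y = c *: ptr t z + y'].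

Lemma adjoin_subgraph G s b z : subgraph G -> subgraph (@adjoin G s b z).
Proof.
move=> sG; split=> [t|t c _ _ _ _ [e [x [y [Gxy -> ->]]]]
                       [e' [x' [y' [Gxy' -> ->]]]]|t u h _ _ [e [x [y [Gxy -> ->]]]]].
- by exists 0, 0, 0; split; [exact: (sg0 sG)|rewrite scale0r addr0..].
- exists (c * e + e'), (c *: x + x'), (c *: y + y'); split.
  + exact: (sgP sG).
  + by rewrite scalerDl scalerDr scalerA addrACA.
  + by rewrite scalerDl scalerDr scalerA addrACA.
- have [st|nst] := pselect (s <= t)%O.
    exists e, (pm_map B h x), (pm_map I h y); split.
    + exact: (sg_nat sG).
    + by rewrite linearP pm_map_ptr.
    + by rewrite linearP pm_map_ptr.
  exists 0, (pm_map B h x), (pm_map I h y); split.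
  + exact: (sg_nat sG).
  + by rewrite ptr_eq0 // scaler0 add0r scale0r add0r.
  + by rewrite ptr_eq0 // scaler0 add0r scale0r add0r.
Qed.

Lemma adjoin_univalent G s (b : B s) : subgraph G -> univalent G ->
  exists z, univalent (adjoin G b z).
Proof.
move=> sG uG.
(* [G] is already defined on the images of [b] above [J]; flabbiness gives a
   value [z] at [b] that is compatible with these prescribed values. *)
pose J t := (s <= t)%O /\ exists y, G t (ptr t b) y.
pose y t : I t := if pselect (J t) is left h then projT1 (cid h.2) else 0.
have yP t : J t -> G t (ptr t b) (y t).
  by rewrite /y; case: pselect => // h _; case: cid.
have JU t u (tu : (t <= u)%O) : J t -> G u (ptr u b) (pm_map I tu (y t)).
  by move=> Jt; rewrite -(pm_map_ptr tu _ Jt.1); apply/(sg_nat sG)/yP.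
have [|||z zP] := flI (J := J) (s := s) (y := y).
- move=> t u tu Jt; split; first exact: le_trans Jt.1 tu.
  by exists (pm_map I tu (y t)); apply: JU.
- by move=> t [].
- move=> t u tu Jt; apply: (univalentP sG uG (JU _ _ tu Jt)).
  apply: yP; split; first exact: le_trans Jt.1 tu.
  by exists (pm_map I tu (y t)); apply: JU.
exists z => t v [c [x' [y' [Gxy xE ->]]]].
have x'E : x' = - (c *: ptr t b).
  by apply/eqP; rewrite -addr_eq0 addrC -xE.
have [c0|c0] := eqVneq c 0.
  move: x'E Gxy; rewrite c0 !scale0r oppr0 => -> Gy.
  by rewrite (uG _ _ Gy) addr0.
have [st|nst] := pselect (s <= t)%O; last first.
  move: x'E Gxy; rewrite !ptr_eq0 // scaler0 oppr0 => -> Gy.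
  by rewrite (uG _ _ Gy) scaler0 addr0.
have Jt : J t.
  split=> //; exists (- c^-1 *: y').
  have := sgP sG (- c^-1) Gxy (sg0 sG t); rewrite !addr0 x'E.
  by rewrite scaleNr scalerN opprK scalerA mulVf // scale1r scaleNr.
rewrite (ptrE st) (zP _ st Jt).
apply: (uG t); have := sgP sG c (yP _ Jt) Gxy.
by rewrite x'E addrN.
Qed.

(** Zorn's lemma on the partial morphisms that contain [G0]: a maximal one is
total, because a flabby target always allows one more element to be adjoined. *)
Lemma flabby_extend (G0 : forall t, B t -> I t -> Prop) :
  subgraph G0 -> univalent G0 ->
  exists h : phom B I, forall t x y, G0 t x y -> h t x = y.
Proof.
move=> sG0 uG0.
pose T := {G : forall t, B t -> I t -> Prop |
  [/\ subgraph G, univalent G & forall t x y, G0 t x y -> G t x y]}.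
pose le (G G' : T) := forall t x y, sval G t x y -> sval G' t x y.
pose R : rel T := fun G G' => `[< le G G' >].
pose base : T := exist _ G0 (And3 sG0 uG0 (fun _ _ _ h => h)).
have baseP (G : T) : le base G by case: G => G [].
have [||||G maxG] := @Zorn T R.
- by move=> G; apply/asboolP.
- by move=> G G' G'' /asboolP h /asboolP h'; apply/asboolP => t x y /h /h'.
- move=> [G hG] [G' hG'] /asboolP h /asboolP h'; apply: eq_exist => /=.
  apply: functional_extensionality_dep => t; apply: funext => x; apply: funext => y.
  by apply/propext; split; [exact: h|exact: h'].
- move=> A Atot.
  pose A' G := A G \/ G = base.
  have A'tot G G' : A' G -> A' G' -> le G G' \/ le G' G.
    case=> [AG|->]; last by left; apply: baseP.
    case=> [AG'|->]; last by right; apply: baseP.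
    by case: (Atot _ _ AG AG') => /asboolP; [left|right].
  pose U t x y := exists2 G, A' G & sval G t x y.
  have U0 t x y : G0 t x y -> U t x y by move=> h; exists base => //; right.
  have sU : subgraph U.
    split=> [t|t c x y x' y' [G AG Gxy] [G' AG' Gxy']|s t h x y [G AG Gxy]].
    + by apply: U0; apply: (sg0 sG0).
    + have [GG'|G'G] := A'tot _ _ AG AG'.
        by exists G' => //; have [s _ _] := svalP G'; apply: (sgP s) => //; apply: GG'.
      by exists G => //; have [s _ _] := svalP G; apply: (sgP s) => //; apply: G'G.
    + by exists G => //; have [sG _ _] := svalP G; apply: (sg_nat sG).
  have uU : univalent U by move=> t y [[G [? uG ?]] _ /= /uG].
  exists (exist _ U (And3 sU uU U0)) => G AG; apply/asboolP => t x y Gxy.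
  by exists G => //; left.
case: G maxG => G [sG uG GG0] maxG.
have tG t x : exists y, G t x y.
  have [z uz] := adjoin_univalent x sG uG.
  have G'G s u v : G s u v -> adjoin G x z u v.
    by move=> Guv; exists 0, u, v; rewrite !scale0r !add0r.
  pose G' : T := exist _ (adjoin G x z) (And3 (adjoin_subgraph x z sG) uz
    (fun s u v h => G'G s u v (GG0 s u v h))).
  have /(congr1 sval)/= E : G' = exist _ G (And3 sG uG GG0).
    by apply: maxG; apply/asboolP.
  exists z; rewrite -E; exists 1, 0, 0; split; first exact: (sg0 sG).
    by rewrite ptr_id scale1r addr0.
  by rewrite ptr_id scale1r addr0.
have [h hP] := phom_of_graph sG uG tG.
by exists h => t x y /GG0; apply: (univalentP sG uG).
Qed.

End Extension.

Lemma flabby_injective I : flabby I -> pinjective I.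
Proof.
move=> flI A B f g monof.
pose G t (x : B t) (y : I t) := exists a, f t a = x /\ g t a = y.
have sG : subgraph G.
  split=> [t|t c _ _ _ _ [a [<- <-]] [a' [<- <-]]|s t h _ _ [a [<- <-]]].
  - by exists 0; rewrite !raddf0.
  - by exists (c *: a + a'); rewrite !linearP.
  - by exists (pm_map A h a); rewrite !ph_nat.
have uG : univalent G.
  move=> t y [a [fa <-]].
  by have -> : a = 0 by [apply: (monof t); rewrite fa raddf0]; rewrite raddf0.
have [h hP] := flabby_extend flI sG uG.
by exists h => t x; apply: hP; exists x.
Qed.

(** The relation that sends [g b] to [u b] is univalent by exactness; it is
only defined on the image of [g] and has to be extended to [C]. *)
Lemma flabby_hom_exact I (A B C : pmod k Q) (f : phom A B) (g : phom B C)
    (u : phom B I) :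
  flabby I -> pexact f g -> (forall t x, u t (f t x) = 0) ->
  exists v : phom C I, forall t x, v t (g t x) = u t x.
Proof.
move=> flI ex uf.
pose G t (x : C t) (y : I t) := exists b, g t b = x /\ u t b = y.
have sG : subgraph G.
  split=> [t|t c _ _ _ _ [a [<- <-]] [a' [<- <-]]|s t h _ _ [a [<- <-]]].
  - by exists 0; rewrite !raddf0.
  - by exists (c *: a + a'); rewrite !linearP.
  - by exists (pm_map B h a); rewrite !ph_nat.
have uG : univalent G by move=> t y [b [/ex [a <-] <-]].
have [h hP] := flabby_extend flI sG uG.
by exists h => t x; apply: hP; exists x.
Qed.

Lemma projective_hom_exact P (A B C : pmod k Q) (f : phom A B) (g : phom B C)
    (u : phom P B) :
  pprojective P -> pexact f g -> (forall t x, g t (u t x) = 0) ->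
  exists v : phom P A, forall t x, f t (v t x) = u t x.
Proof.
move=> prP ex gu.
have corestr X (w : phom X B) : (forall t x, g t (w t x) = 0) ->
    exists w' : phom X (pker g), forall t x, val (w' t x) = w t x.
  move=> gw.
  have kw t x : @in_ker _ _ _ _ _ g t (w t x) by rewrite /in_ker gw.
  have lw t : linear (fun x => exist _ (w t x) (kw t x) : pker g t).
    by move=> c x y; apply: val_inj; exact: linearP.
  unshelve eexists (@PHom _ _ _ X (pker g) (fun t x => exist _ (w t x) (kw t x)) lw _).
    by move=> s t h x; apply: val_inj; exact: ph_nat.
  by [].
have [f' f'E] := corestr _ f (fun t x => (ex t (f t x)).2 (ex_intro _ x erefl)).
have [u' u'E] := corestr _ u gu.
have epif' : pepi f'.
  move=> t y; have /ex [x fx] : g t (val y) = 0 by apply/eqP/(valP y).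
  by exists x; apply: val_inj; rewrite f'E.
have [v vP] := prP _ _ f' u' epif'.
by exists v => t x; rewrite -f'E vP u'E.
Qed.

End Flabby.

(** * Godement modules and enough injectives *)

(** A copy of [T] on which the order is equality: limits over it are products. *)
Definition discrete (T : Type) : Type := T.

Section Discrete.
Variable T : choiceType.
HB.instance Definition _ := Choice.on (discrete T).

Fact discrete_anti : antisymmetric (@eq_op (discrete T)).
Proof. by move=> x y /andP[/eqP]. Qed.
Fact discrete_trans : transitive (@eq_op (discrete T)).
Proof. by move=> x y z /eqP -> /eqP ->. Qed.
HB.instance Definition _ := Order.Le_isPOrder.Build Order.default_display
  (discrete T) (@eqxx (discrete T)) discrete_anti discrete_trans.

End Discrete.

Section Godement.
Variables (k : fieldType) (d : Order.disp_t) (Q : porderType d).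
Implicit Types M I : pmod k Q.

Definition undisc (q : discrete Q) : Q := q.
Fact undisc_homo : {homo undisc : x y / (x <= y)%O}.
Proof. by move=> x y /eqP ->. Qed.
HB.instance Definition _ := Order.isOrderMorphism.Build _ _ _ _ undisc undisc_homo.

(** The Godement module: restrict [M] to the points of [Q] and push forward
again. Its stalk at [t] is the product of the stalks of [M] above [t]. *)
Definition godement M : pmod k Q := pushforward undisc (pullback undisc M).

Lemma godement_compat M t (x : forall s, M s)
    (p p' : subposet (above undisc t)) (h : (p <= p')%O) :
  pm_map (restr (above undisc t) (pullback undisc M)) h (x (val p)) = x (val p').
Proof.
case: p p' h => [p hp] [p' hp'] h; have E : p = p' by apply/eqP.
by subst p'; exact: (@pm_id k d Q M p _ (x p)).
Qed.

Definition family M t (x : forall s, M s) : godement M t :=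
  PLim (godement_compat (t := t) x).

Definition component M t (x : godement M t) s (h : (t <= s)%O) : M s :=
  lim_fun x (exist (above undisc t) s h).

Lemma componentE M t (x y : godement M t) :
  (forall s (h : (t <= s)%O), component x h = component y h) -> x = y.
Proof. by move=> xy; apply: plim_ext => -[s h]; apply: xy. Qed.

Lemma component_map M t u (tu : (t <= u)%O) (x : godement M t) s
    (us : (u <= s)%O) (ts : (t <= s)%O) :
  component (pm_map (godement M) tu x) us = component x ts.
Proof. exact: (@plim_irr _ _ _ _ (pullback undisc M) x). Qed.

(** An element of a product is given by its components, and the component at
[u] of the required extension can be read off the family at [u] itself. *)
Lemma godement_flabby M : flabby (godement M).
Proof.
move=> J s y JU Js yc.
pose c u : M u := if pselect (J u) is left _ then component (y u) (lexx u) else 0.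
exists (family s c) => t st Jt; apply: componentE => u tu.
rewrite (component_map _ _ _ (le_trans st tu)) [LHS]/= /c.
case: pselect => [Ju|/(_ (JU _ _ tu Jt)) //].
by rewrite -(yc _ _ tu Jt) (component_map _ _ _ tu).
Qed.

Lemma godement_unit M : exists f : phom M (godement M), pmono f.
Proof.
pose f t (x : M t) : godement M t := family t (fun s => ptr s x).
have lf t : linear (f t).
  by move=> c x y; apply: plim_ext => p /=; exact: ptr_linear.
have nf s t (h : (s <= t)%O) x : f t (pm_map M h x) = pm_map (godement M) h (f s x).
  apply: componentE => u tu; rewrite (component_map _ _ _ (le_trans h tu)) /=.
  by rewrite (ptrE tu) (ptrE (le_trans h tu)) (pm_comp h tu).
exists (PHom lf nf) => t x y /(congr1 (fun z => component z (lexx t))).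
by rewrite /= /component /= !ptr_id.
Qed.

Lemma flabby_retract I M (i : phom I M) (r : phom M I) :
  (forall t, cancel (i t) (r t)) -> flabby M -> flabby I.
Proof.
move=> ri flM J s y JU Js yc.
have [|z zP] := flM J s (fun t => i t (y t)) JU Js.
  by move=> t u h Jt; rewrite -ph_nat yc.
by exists (r s z) => t st Jt; rewrite -ph_nat (zP _ st Jt) ri.
Qed.

(** An injective module is a retract of its Godement module, and the extension
property passes to retracts. *)
Lemma injective_flabby I : pinjective I -> flabby I.
Proof.
move=> injI; have [i mi] := godement_unit I.
have [r ri] := injI _ _ i (phom_id I) mi.
exact: flabby_retract ri (godement_flabby (M := I)).
Qed.

Definition coker_proj M N (f : phom M N) : phom N (pcoker f) :=
  @PHom k d Q N (pcoker f) (fun t x => lproj (im_sub f t) x)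
    (fun t => @lproj_linear _ _ (im_sub f t))
    (fun s t h x => esym (coker_mapE f h x)).

Lemma coker_projP M N (f : phom M N) : pexact f (coker_proj f).
Proof.
move=> t y; rewrite /= -(raddf0 (lproj (im_sub f t))).
split=> [/lprojE|[x <-]]; rewrite ?subr0; first by move/asboolP.
by apply/lprojE; rewrite subr0; apply/asboolP; exists x.
Qed.

Lemma coker_proj_epi M N (f : phom M N) : pepi (coker_proj f).
Proof. by move=> t y; exists (lrepr y); exact: lreprK. Qed.

(** The successive cokernels of the embeddings in Godement modules; their
Godement modules form an injective resolution of [M]. *)
Fixpoint cosyzygy M (n : nat) : pmod k Q :=
  if n is n'.+1 then pcoker (projT1 (cid (godement_unit (cosyzygy M n')))) else M.

Lemma enough_injectives M : inhabited (inj_resolution M).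
Proof.
pose i n : phom (cosyzygy M n) (godement (cosyzygy M n)) :=
  projT1 (cid (godement_unit (cosyzygy M n))).
have mi n : pmono (i n) by rewrite /i; case: cid.
pose q n : phom (godement (cosyzygy M n)) (cosyzygy M n.+1) := coker_proj (i n).
have ex n : pexact (i n) (phom_comp (i n.+1) (q n)).
  exact: (@pexact_mono _ _ _ _ _ _ _ (i n) (q n) (i n.+1) (coker_projP (i n)) (mi n.+1)).
have dd n : pexact (phom_comp (i n.+1) (q n)) (phom_comp (i n.+2) (q n.+1)).
  exact: (@pexact_epi _ _ _ _ _ _ _ (q n) (i n.+1) _ (coker_proj_epi (f := i n)) (ex n.+1)).
have inj n : pinjective (godement (cosyzygy M n)).
  exact/flabby_injective/godement_flabby.
constructor; exact: (@InjResolution k d Q M (fun n => godement (cosyzygy M n))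
  (fun n => phom_comp (i n.+1) (q n)) (i 0) inj (mi 0) (ex 0) dd).
Qed.

End Godement.

(** * Free modules and enough projectives *)

Section Free.
Variables (k : fieldType) (d : Order.disp_t) (Q : porderType d) (M : pmod k Q).

Local Notation gen := {s : Q & M s}.

(** A list that witnesses the finiteness of the support of [f]. *)
Definition carried (t : Q) (L : seq gen) (f : gen -> k^o) :=
  [/\ uniq L, forall x, x \in L -> (tag x <= t)%O & forall x, x \notin L -> f x = 0].

Definition finsupp (t : Q) : pred (gen -> k^o) :=
  fun f => `[< exists L, carried t L f >].

Lemma carried_cat t L L' f f' : carried t L f -> carried t L' f' ->
  [/\ carried t (undup (L ++ L')) f, carried t (undup (L ++ L')) f' &
  forall c, carried t (undup (L ++ L')) (c *: f + f')].
Proof.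
move=> [uL tL fL] [uL' tL' fL'].
have tU x : x \in undup (L ++ L') -> (tag x <= t)%O.
  by rewrite mem_undup mem_cat => /orP[/tL|/tL'].
have E x : x \notin undup (L ++ L') -> f x = 0 /\ f' x = 0.
  by rewrite mem_undup mem_cat negb_or => /andP[/fL -> /fL' ->].
split=> [||c]; split=> //; rewrite ?undup_uniq //; move=> x /E[h h'] //.
by rewrite [LHS](_ : _ = c * f x + f' x) // h h' mulr0 addr0.
Qed.

Fact finsupp_submod t : submod_closed (finsupp t).
Proof.
split=> [|c f f']; rewrite !unfold_in /finsupp.
  by apply/asboolP; exists [::]; split.
move=> /asboolP[L cL] /asboolP[L' cL']; apply/asboolP.
by have [_ _ /(_ c)] := carried_cat cL cL'; eexists; eassumption.
Qed.
HB.instance Definition _ t :=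
  GRing.isSubmodClosed.Build k (gen -> k^o) (finsupp t) (finsupp_submod t).

(** The free module on one generator in degree [s] for every [s] and every
element of the stalk of [M] at [s]. At [t] it consists of the finitely
supported functions on the generators of degree at most [t], so that the
transition maps are inclusions. *)
Definition free_obj (t : Q) := {f : gen -> k^o | finsupp t f}.
HB.instance Definition _ t := SubType.copy (free_obj t) {f : gen -> k^o | finsupp t f}.
HB.instance Definition _ t := [Choice of free_obj t by <:].
HB.instance Definition _ t := [SubChoice_isSubLmodule of free_obj t by <:].

Lemma free_map_subproof s t (h : (s <= t)%O) (f : free_obj s) : finsupp t (val f).
Proof.
have /asboolP[L [uL sL fL]] := valP f; apply/asboolP; exists L; split=> // x xL.
exact: le_trans (sL x xL) h.
Qed.
Definition free_map s t (h : (s <= t)%O) (f : free_obj s) : free_obj t :=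
  Sub (val f) (free_map_subproof h f).
Lemma free_map_linear s t (h : (s <= t)%O) : linear (free_map h).
Proof. by move=> c x y; apply: val_inj. Qed.
HB.instance Definition _ s t (h : (s <= t)%O) :=
  GRing.isLinear.Build k (free_obj s) (free_obj t) _ (free_map h) (free_map_linear h).

Program Definition free_pmod : pmod k Q := @PMod k d Q free_obj (fun s t h => free_map h) _ _.
Next Obligation. by move=> s h x; apply: val_inj. Qed.
Next Obligation. by move=> r s t h h' h'' x; apply: val_inj. Qed.

Lemma basis_subproof (x : gen) : finsupp (tag x) (fun y => (y == x)%:R).
Proof.
apply/asboolP; exists [:: x]; split=> // y; rewrite inE; first by move/eqP ->.
by move/negbTE ->.
Qed.
Definition basis (x : gen) : free_pmod (tag x) := Sub (fun y => (y == x)%:R) (basis_subproof x).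

Section Lift.
Variables (A : pmod k Q) (a : forall x : gen, A (tag x)).

Definition evaluate t (L : seq gen) (f : gen -> k^o) : A t :=
  \sum_(x <- L) (f x : k) *: ptr t (a x).

(** Sums over different lists that carry [f] agree, so the choice of the list
does not matter. *)
Lemma evaluate_sub t (L L' : seq gen) f :
  uniq L -> uniq L' -> {subset L <= L'} -> (forall x, x \notin L -> f x = 0) ->
  evaluate t L f = evaluate t L' f.
Proof.
move=> uL uL' LL' fL; rewrite /evaluate [RHS](bigID (mem L)) /=.
rewrite [X in _ + X]big1 ?addr0; last by move=> x /fL ->; rewrite scale0r.
rewrite -[RHS]big_filter; apply: perm_big; apply: uniq_perm; rewrite ?filter_uniq //.
by move=> x; rewrite mem_filter andb_idr // => /LL'.
Qed.

(** The universal property: the images of the generators determine a morphism. *)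
Lemma free_lift : exists h : phom free_pmod A, forall t (f : free_pmod t) L,
  carried t L (val f) -> h t f = evaluate t L (val f).
Proof.
pose G t (f : free_pmod t) y := exists2 L, carried t L (val f) & y = evaluate t L (val f).
have sG : subgraph G.
  split=> [t|t c f _ f' _ [L cL ->] [L' cL' ->]|s t h f _ [L [uL sL fL] ->]].
  - by exists [::]; [|rewrite /evaluate big_nil].
  - have [[uU _ _] _ cU] := carried_cat cL cL'; exists (undup (L ++ L')); first exact: (cU c).
    have [[uL _ fL] [uL' _ fL']] := (cL, cL').
    have -> : evaluate t L (val f) = evaluate t (undup (L ++ L')) (val f).
      by apply: evaluate_sub => // x xL; rewrite mem_undup mem_cat xL.
    have -> : evaluate t L' (val f') = evaluate t (undup (L ++ L')) (val f').
      by apply: evaluate_sub => // x xL; rewrite mem_undup mem_cat xL orbT.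
    rewrite /evaluate scaler_sumr -big_split /=; apply: eq_bigr => x _.
    by rewrite scalerA -scalerDl.
  - exists L; first by split=> // x /sL xs; exact: le_trans xs h.
    rewrite /evaluate linear_sum; apply: eq_big_seq => x /sL xs.
    by rewrite linearZ /= pm_map_ptr.
have uG : univalent G.
  by move=> t y [L _ ->]; rewrite /evaluate big1 // => x _; rewrite scale0r.
have tG t f : exists y, G t f y.
  by have /asboolP[L cL] := valP f; exists (evaluate t L (val f)), L.
have [h hP] := phom_of_graph sG uG tG.
by exists h => t f L cL; apply: (univalentP sG uG (hP t f)); exists L.
Qed.

End Lift.

Lemma evaluate_basis t L (f : free_pmod t) : carried t L (val f) ->
  evaluate basis t L (val f) = f.
Proof.
move=> [uL tL fL]; apply: val_inj; rewrite /evaluate.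
apply: funext => y.
have -> : val (\sum_(x <- L) val f x *: ptr t (basis x)) y =
          \sum_(x <- L) val f x * (y == x)%:R.
  elim: {uL fL} L tL => [|x L IH] tL; first by rewrite !big_nil.
  rewrite !big_cons -IH => [|z zL]; last by apply: tL; rewrite inE zL orbT.
  by rewrite (ptrE (tL x (mem_head _ _))).
have [yL|yL] := boolP (y \in L).
  rewrite (bigD1_seq y) //= eqxx mulr1 big1 ?addr0 // => x /negbTE.
  by rewrite eq_sym => ->; rewrite mulr0.
rewrite fL // big_seq big1 // => x xL.
by case: eqP xL yL => [<- ->|_ _ _] //; rewrite mulr0.
Qed.

(** Lift the images of the generators one by one, by choice. *)
Lemma free_projective : pprojective free_pmod.
Proof.
move=> A B f g epif.
have [h hP] := free_lift (fun x => projT1 (cid (epif _ (g _ (basis x))))).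
exists h => t x; have /asboolP[L cL] := valP x.
rewrite (hP _ _ _ cL) -[in RHS](evaluate_basis cL) /evaluate !linear_sum.
apply: eq_bigr => y _; rewrite !linearZ /= !ph_ptr; congr (_ *: ptr t _).
by case: cid.
Qed.

Lemma free_counit : exists f : phom free_pmod M, pepi f.
Proof.
have [f fP] := free_lift (fun x => tagged x).
exists f => t y; pose x : gen := Tagged (fun s => M s) y.
exists (basis x).
rewrite (fP t (basis x) [:: x]); first by rewrite /evaluate big_seq1 /= eqxx scale1r ptr_id.
split=> // z; rewrite inE; first by move/eqP ->.
by rewrite /= => /negbTE ->.
Qed.

End Free.

Section EnoughProjectives.
Variables (k : fieldType) (d : Order.disp_t) (Q : porderType d).
Implicit Types M : pmod k Q.

Definition ker_incl M N (f : phom M N) : phom (pker f) M :=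
  @PHom k d Q (pker f) M (fun t x => val x) (fun t c x y => linearP _ c x y)
    (fun s t h x => erefl).

Lemma ker_inclP M N (f : phom M N) : pexact (ker_incl f) f.
Proof.
move=> t y; split=> [fy|[x <-]]; last exact/eqP/(valP x).
by exists (exist _ y (introT eqP fy)).
Qed.

Lemma ker_incl_mono M N (f : phom M N) : pmono (ker_incl f).
Proof. by move=> t; exact: val_inj. Qed.

(** The successive kernels of the free covers; their free covers form a
projective resolution of [M]. *)
Fixpoint syzygy M (n : nat) : pmod k Q :=
  if n is n'.+1 then pker (projT1 (cid (free_counit (syzygy M n')))) else M.

Lemma enough_projectives M : inhabited (proj_resolution M).
Proof.
pose e n : phom (free_pmod (syzygy M n)) (syzygy M n) :=
  projT1 (cid (free_counit (syzygy M n))).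
have ee n : pepi (e n) by rewrite /e; case: cid.
pose j n : phom (syzygy M n.+1) (free_pmod (syzygy M n)) := ker_incl (e n).
have ex n : pexact (phom_comp (j n) (e n.+1)) (e n).
  exact: (@pexact_epi _ _ _ _ _ _ _ (e n.+1) (j n) (e n) (ee n.+1) (ker_inclP (e n))).
have dd n : pexact (phom_comp (j n.+1) (e n.+2)) (phom_comp (j n) (e n.+1)).
  exact: (@pexact_mono _ _ _ _ _ _ _ _ (e n.+1) (j n) (ex n.+1) (ker_incl_mono (f := e n))).
have proj n : pprojective (free_pmod (syzygy M n)) by exact: free_projective.
constructor; exact: (@ProjResolution k d Q M (fun n => free_pmod (syzygy M n))
  (fun n => phom_comp (j n) (e n.+1)) (e 0) proj (ee 0) (ex 0) dd).
Qed.

End EnoughProjectives.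

(** * Pullbacks of flabby modules *)

(** A compatible family over an up-set [J] of [P] pushes forward to one over the
up-set generated by the image of [J], and the latter extends. The pushed
family is well defined because any two elements of [J] are comparable. This
replaces the exactness of the left Kan extension along [h]. *)
Lemma flabby_pullback (k : fieldType) d (P : orderType d) d' (Q : porderType d')
    (h : {omorphism P -> Q}) (I : pmod k Q) : flabby I -> flabby (pullback h I).
Proof.
move=> flI J s y JU Js yc.
have yE u x x' : J x -> J x' -> (h x <= u)%O -> (h x' <= u)%O ->
    ptr u (y x : I (h x)) = ptr u (y x' : I (h x')).
  wlog xx' : x x' / (x <= x')%O.
    by case/orP: (le_total x x') => xx' H *; [apply: H|apply/esym/H].
  move=> Jx Jx' xu x'u; rewrite -(yc _ _ xx' Jx) /=.
  by rewrite (ptrE xu) (ptrE x'u) -pm_comp.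
pose J' u := exists x, J x /\ (h x <= u)%O.
pose y' u : I u := if pselect (J' u) is left e then ptr u (y (projT1 (cid e))) else 0.
have y'E u x : J x -> (h x <= u)%O -> y' u = ptr u (y x : I (h x)).
  move=> Jx xu; rewrite /y'; case: pselect => [e|[]]; last by exists x.
  by case: (cid e) => x' /= [Jx' x'u]; apply: yE.
have [|||z zP] := flI J' (h s) y'.
- by move=> t u tu [x [Jx xt]]; exists x; split=> //; exact: le_trans xt tu.
- by move=> t [x [Jx xt]]; apply: le_trans xt; apply/omorph_le/Js.
- move=> t u tu [x [Jx xt]].
  by rewrite (y'E _ _ Jx xt) (y'E _ _ Jx (le_trans xt tu)) pm_map_ptr.
exists z => t st Jt /=; rewrite (zP (h t)); last by exists t.
by rewrite (y'E _ _ Jt (lexx _)) ptr_id.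
Qed.

(** * Stalks of the internal hom *)

Section InternalHom.
Variables (k : fieldType) (d : Order.disp_t) (Q : porderType d).
Variable phi : {omorphism (Q *p Q)%type -> Q}.
Implicit Types M N : pmod k Q.

Definition slice (t x : Q) : Q := phi (x, t).
Fact slice_homo t : {homo slice t : x y / (x <= y)%O}.
Proof. by move=> x y xy; apply: omorph_le; apply/andP. Qed.
HB.instance Definition _ t :=
  Order.isOrderMorphism.Build _ _ _ _ (slice t) (slice_homo t).

Lemma slice_le t u x : (t <= u)%O -> (slice t x <= slice u x)%O.
Proof. by move=> tu; apply: (omorph_le phi); apply/andP. Qed.

Local Notation ihom := (ihom phi).
Local Notation QQ := (Q *p Q)%type.

(** An element of the internal hom at [t] is a compatible family, indexed by the
pairs [z] whose second coordinate is above [t], of morphisms over the up-sets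
of these pairs; this is the morphism at [z] applied at the point [z']. *)
Definition at_pair M N t (x : ihom M N t) (z : QQ) (tz : (t <= pr2 z)%O)
    (z' : QQ) (zz' : (z <= z')%O) : M (pr1 z') -> N (phi z') :=
  ph_fun (lim_fun x (exist (above (@pr2 _ Q) t) z tz)) (t := exist (upset z) z' zz').

Lemma at_pair_compat M N t (x : ihom M N t) (z w z' : QQ) (tz : (t <= pr2 z)%O)
    (tw : (t <= pr2 w)%O) (zz' : (z <= z')%O) (wz' : (w <= z')%O) m :
  (z <= w)%O -> at_pair x tz zz' m = at_pair x tw wz' m.
Proof.
move=> zw; pose p : subposet (above (@pr2 _ Q) t) := exist _ z tz.
pose p' : subposet (above (@pr2 _ Q) t) := exist _ w tw.
have := lim_compat x (zw : (p <= p')%O).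
move=> /(congr1 (fun f : shom_obj (pullback (@pr1 _ Q) M) (pullback phi N) w =>
  ph_fun f (t := exist (upset w) z' wz') m)) E.
apply: etrans E.
exact: (@phom_irr k _ _ (upset z) (pullback (@pr1 _ Q) M) (pullback phi N)
  (lim_fun x p) z' _ _ m).
Qed.

Lemma at_pair_nat M N t (x : ihom M N t) (z z' z'' : QQ) (tz : (t <= pr2 z)%O)
    (zz' : (z <= z')%O) (zz'' : (z <= z'')%O) (z'z'' : (z' <= z'')%O)
    (h1 : (pr1 z' <= pr1 z'')%O) (h2 : (phi z' <= phi z'')%O) m :
  at_pair x tz zz'' (pm_map M h1 m) = pm_map N h2 (at_pair x tz zz' m).
Proof.
pose p : subposet (upset z) := exist _ z' zz'.
pose p' : subposet (upset z) := exist _ z'' zz''.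
have := ph_nat (lim_fun x (exist (above (@pr2 _ Q) t) z tz)) (z'z'' : (p <= p')%O) m.
rewrite /at_pair => E; apply: etrans (etrans E _).
  by congr (ph_fun _ _); exact: (@pm_map_irr _ _ _ M).
exact: (@pm_map_irr _ _ _ N).
Qed.

Lemma prod_le (a b a' b' : Q) : (a <= a')%O -> (b <= b')%O ->
  (((a, b) : QQ) <= (a', b'))%O.
Proof. by move=> h h'; apply/andP. Qed.

Definition ev_fun M N t (x : ihom M N t) s : M s -> N (slice t s) :=
  at_pair x (z := (s, t)) (z' := (s, t)) (lexx t) (lexx _).
Arguments ev_fun {M N t} x s.

Lemma ev_linear M N t (x : ihom M N t) s : linear (ev_fun x s).
Proof.
pose p : subposet (above (@pr2 _ Q) t) := exist _ ((s, t) : QQ) (lexx t).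
exact: (@ph_lin _ _ _ _ _ (lim_fun x p) (exist _ ((s, t) : QQ) (lexx _))).
Qed.

Lemma ev_nat M N t (x : ihom M N t) s s' (h : (s <= s')%O) m :
  ev_fun x s' (pm_map M h m) = pm_map (pullback (slice t) N) h (ev_fun x s m).
Proof.
have hh := prod_le h (lexx t).
rewrite /ev_fun.
rewrite -(@at_pair_compat M N t x (s, t) (s', t) (s', t) (lexx t) (lexx t) hh (lexx _)) //.
exact: (@at_pair_nat M N t x (s, t) (s, t) (s', t)).
Qed.

(** The isomorphism from the internal hom at [t] to the morphisms from [M] to
the pullback of [N] along a slice: keep only the points with second coordinate
exactly [t]. *)
Definition ev M N t (x : ihom M N t) : phom M (pullback (slice t) N) :=
  @PHom k d Q M (pullback (slice t) N) (ev_fun x) (ev_linear x) (ev_nat x).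

(** Compatibility lets [z] be replaced by [z'] and then by the smaller pair
with the same first coordinate and second coordinate [t]; naturality moves
the point of application down to that pair as well. So an element of the
internal hom is determined by its values under [ev]. *)
Lemma at_pairE M N t (x : ihom M N t) (z z' : QQ) (tz : (t <= pr2 z)%O)
    (zz' : (z <= z')%O) (h : (phi (pr1 z', t) <= phi z')%O) m :
  at_pair x tz zz' m = pm_map N h (ev x (pr1 z') m).
Proof.
have tz' : (t <= pr2 z')%O by apply: le_trans tz (pr2_homo zz').
have wz' : (((pr1 z', t) : QQ) <= z')%O by apply/andP.
rewrite (at_pair_compat x tz tz' zz' (lexx z')) //.
rewrite -(@at_pair_compat M N t x (pr1 z', t) z' z' (lexx t) tz' wz' (lexx z')) //.
have := @at_pair_nat M N t x (pr1 z', t) (pr1 z', t) z' (lexx t) (lexx _) wz' wz' (lexx _) h m.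
by rewrite pm_id.
Qed.

Lemma ev_inj M N t (x y : ihom M N t) :
  (forall s m, ev x s m = ev y s m) -> x = y.
Proof.
move=> xy; apply: plim_ext => -[z tz]; apply: phom_ext => -[z' zz'] m.
have wz' : (((pr1 z', t) : QQ) <= z')%O.
  by apply/andP; split; last exact: le_trans tz (pr2_homo zz').
have h := omorph_le phi wz'.
apply: etrans (at_pairE x tz zz' h m) _; rewrite xy.
exact/esym/(at_pairE y tz zz' h m).
Qed.

Lemma ev_surj M N t (g : phom M (pullback (slice t) N)) :
  exists x : ihom M N t, forall s m, ev x s m = g s m.
Proof.
have le_z (z : QQ) : (t <= pr2 z)%O -> (slice t (pr1 z) <= phi z)%O.
  by case: z => z1 z2 tz; apply: (omorph_le phi); apply/andP.
pose f (z : QQ) (tz : (t <= pr2 z)%O) (w : subposet (upset z))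
    (m : M (pr1 (val w))) : N (phi (val w)) :=
  pm_map N (le_z (val w) (le_trans tz (pr2_homo (valP w)))) (g (pr1 (val w)) m).
have flin z tz w : linear (@f z tz w).
  by move=> c m m'; rewrite /f !linearP.
have fnat z tz (w w' : subposet (upset z)) (h : (w <= w')%O) m :
    @f z tz w' (pm_map (restr (upset z) (pullback (@pr1 _ Q) M)) h m) =
    pm_map (restr (upset z) (pullback phi N)) h (@f z tz w m).
  have hx : (slice t (pr1 (val w)) <= phi (val w'))%O.
    by apply: le_trans (le_z _ (le_trans tz (pr2_homo (valP w)))) _; apply: omorph_le.
  rewrite /f ph_nat; apply: etrans (esym _) _; first exact: (@pm_comp _ _ _ N _ _ _ _ _ hx).
  exact: (@pm_comp _ _ _ N _ _ _ _ _ hx).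
pose X (p : subposet (above (@pr2 _ Q) t)) :
    shom_obj (pullback (@pr1 _ Q) M) (pullback phi N) (val p) :=
  @PHom k _ (subposet (upset (val p))) (restr (upset (val p)) (pullback (@pr1 _ Q) M))
    (restr (upset (val p)) (pullback phi N))
    (@f (val p) (valP p)) (@flin _ (valP p)) (@fnat _ (valP p)).
have Xc (p p' : subposet (above (@pr2 _ Q) t)) (h : (p <= p')%O) :
    pm_map (restr (above (@pr2 _ Q) t)
      (shom (pullback (@pr1 _ Q) M) (pullback phi N))) h (X p) = X p'.
  by apply: phom_ext => w m; exact: (@pm_map_irr _ _ _ N).
exists (PLim Xc) => s m.
exact: (@pm_id _ _ _ N).
Qed.

Lemma evP M N t c (x y : ihom M N t) s m :
  ev (c *: x + y) s m = c *: ev x s m + ev y s m.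
Proof. by []. Qed.

Lemma ev_map M M' N N' (f : phom M' M) (g : phom N N') t (x : ihom M N t) s m :
  ev (ihom_map phi f g t x) s m = g (slice t s) (ev x s (f s m)).
Proof. by []. Qed.

Lemma ev_res M N t u (tu : (t <= u)%O) (x : ihom M N t) s
    (h : (slice t s <= slice u s)%O) m :
  ev (pm_map (ihom M N) tu x) s m = pm_map N h (ev x s m).
Proof.
have tz : (t <= pr2 ((s, u) : QQ))%O by exact: tu.
rewrite -[RHS](@at_pairE M N t x (s, u) (s, u) tz (lexx _) h m).
have irr (h1 h2 : (t <= pr2 ((s, u) : QQ))%O) :
  at_pair x h1 (lexx _) m = at_pair x h2 (lexx _) m by rewrite (bool_irrelevance h1 h2).
exact: irr.
Qed.

End InternalHom.

Section IhomExact.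
Variables (k : fieldType) (d : Order.disp_t) (Q : porderType d).
Variable phi : {omorphism (Q *p Q)%type -> Q}.
Implicit Types M N : pmod k Q.

Lemma ihom_exactl A B C I (f : phom A B) (g : @phom k d Q B C) :
  (forall t, flabby (pullback (slice phi t) I)) -> pexact f g ->
  pexact (ihom_map phi g (phom_id I)) (ihom_map phi f (phom_id I)).
Proof.
move=> flI ex t u; split=> [uf|[v <-]]; last first.
  apply: ev_inj => s m; rewrite !ev_map.
  have -> : g s (f s m) = 0 by apply/ex; exists m.
  exact: (ph0 (ev v) s).
have uf0 s m : ev u s (f s m) = 0.
  by have := congr1 (fun x => ev x s m) uf; rewrite ev_map.
have [v vg] := flabby_hom_exact (flI t) ex uf0.
have [v' v'E] := ev_surj v.
by exists v'; apply: ev_inj => s m; rewrite ev_map v'E vg.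
Qed.

Lemma ihom_exactr P A B C (f : phom A B) (g : @phom k d Q B C) :
  pprojective P -> pexact f g ->
  pexact (ihom_map phi (phom_id P) f) (ihom_map phi (phom_id P) g).
Proof.
move=> prP ex t u; split=> [gu|[v <-]]; last first.
  apply: ev_inj => s m; rewrite !ev_map /=.
  by apply/ex; exists (ev v s m).
have gu0 s m : pullback_map (slice phi t) g s (ev u s m) = 0.
  by have := congr1 (fun x => ev x s m) gu; rewrite ev_map.
have ex' : pexact (pullback_map (slice phi t) f) (pullback_map (slice phi t) g).
  by move=> s y; apply: ex.
have [v vg] := projective_hom_exact prP ex' gu0.
have [v' v'E] := ev_surj v.
by exists v'; apply: ev_inj => s m; rewrite ev_map v'E; exact: vg.
Qed.

Lemma ihom_monol B C I (g : @phom k d Q B C) :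
  pepi g -> pmono (ihom_map phi g (phom_id I)).
Proof.
move=> eg t u v uv; apply: ev_inj => s c; have [b <-] := eg s c.
by have := congr1 (fun x => ev x s b) uv; rewrite !ev_map.
Qed.

Lemma ihom_monor P A B (f : @phom k d Q A B) :
  pmono f -> pmono (ihom_map phi (phom_id P) f).
Proof.
move=> mf t u v uv; apply: ev_inj => s b; apply: (mf (slice phi t s)).
by have := congr1 (fun x => ev x s b) uv; rewrite !ev_map.
Qed.

(** Bifunctoriality, which makes the internal homs between two resolutions a
double complex. *)
Lemma ihom_mapC A A' I I' (f : phom A A') (g : @phom k d Q I I') t (x : ihom phi A' I t) :
  ihom_map phi f (phom_id I') t (ihom_map phi (phom_id A') g t x) =
  ihom_map phi (phom_id A) g t (ihom_map phi f (phom_id I) t x).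
Proof. by apply: ev_inj => s m; rewrite !ev_map. Qed.

End IhomExact.

(** * Edges of a double complex with exact rows and columns *)

Section Representatives.
Variables (k : fieldType) (d : Order.disp_t) (Q : porderType d).
Variable C : cochain k Q.

(** The cocycles in a cohomology class, uniformly in the degree: [cohomology] is
a kernel in degree 0 and a quotient in the other degrees. *)
Definition represents n t : cohomology C n t -> C n t -> Prop :=
  match n with
  | 0 => fun x u => val x = u
  | i.+1 => fun x u => exists z : pker (cc_d C i.+1) t,
      x = lproj (im_sub (to_cocycle C i) t) z /\ val z = u
  end.

Definition coboundary n t : C n t -> Prop :=
  match n with
  | 0 => fun u => u = 0
  | i.+1 => fun u => exists w, cc_d C i t w = u
  end.

Lemma represents_subgraph n : subgraph (@represents n).
Proof.
case: n => [|i].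
  by split=> [t|t c x _ x' _ <- <-|s t h x _ <-] //=.
split=> [t|t c _ _ _ _ [z [-> <-]] [z' [-> <-]]|s t h _ _ [z [-> <-]]].
- by exists 0; rewrite raddf0.
- by exists (c *: z + z'); rewrite linearP.
- by exists (pm_map (pker (cc_d C i.+1)) h z); rewrite /= coker_mapE.
Qed.

Lemma represents_cocycle n t (x : cohomology C n t) u :
  represents x u -> cc_d C n t u = 0.
Proof. by case: n x u => [|i] x u => [<-|[z [_ <-]]]; exact/eqP/(valP (_ : ker_obj _ _)). Qed.

Lemma representsT n t (x : cohomology C n t) : exists u, represents x u.
Proof.
case: n x => [|i] x; first by exists (val x).
exists (val (lrepr x)), (lrepr x); split=> //; exact/esym/lreprK.
Qed.

Lemma cocycle_represents n t (u : C n t) :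
  cc_d C n t u = 0 -> exists x, @represents n t x u.
Proof.
move=> du; pose z : pker (cc_d C n) t := exist _ u (introT eqP du).
case: n u du @z => [|i] u du z; first by exists z.
by exists (lproj (im_sub (to_cocycle C i) t) z), z.
Qed.

Lemma represents_eq0 n t (x : cohomology C n t) u :
  represents x u -> x = 0 <-> coboundary u.
Proof.
case: n x u => [|i] x u => [/= <-|[z [-> <-]]].
  by split=> [->|x0] //; apply: val_inj.
rewrite -(raddf0 (lproj (im_sub (to_cocycle C i) t))).
split=> [/lprojE|[w wz]].
  by rewrite subr0 => /asboolP[w /(congr1 val) wz]; exists w.
apply/lprojE; rewrite subr0; apply/asboolP; exists w; exact: val_inj.
Qed.

End Representatives.

Section Balance.
Variables (k : fieldType) (d : Order.disp_t) (Q : porderType d).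
Variables (A B : cochain k Q) (C : nat -> nat -> pmod k Q).
Variables (dh : forall p q, phom (C p q) (C p.+1 q)) (dv : forall p q, phom (C p q) (C p q.+1)).
Variables (eA : forall p, phom (A p) (C p 0)) (eB : forall q, phom (B q) (C 0 q)).
Hypothesis dhv : forall p q t x, dh p q.+1 t (dv p q t x) = dv p.+1 q t (dh p q t x).
Hypothesis eAd : forall p t x, eA p.+1 t (cc_d A p t x) = dh p 0 t (eA p t x).
Hypothesis eBd : forall q t x, eB q.+1 t (cc_d B q t x) = dv 0 q t (eB q t x).
Hypothesis eA_mono : forall p, pmono (eA p).
Hypothesis eB_mono : forall q, pmono (eB q).
Hypothesis col0 : forall p, pexact (eA p) (dv p 0).
Hypothesis col : forall p q, pexact (dv p q) (dv p q.+1).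
Hypothesis row0 : forall q, pexact (eB q) (dh 0 q).
Hypothesis row : forall p q, pexact (dh p q) (dh p.+1 q).

(** Addition with [tail_add m.+1 q] convertible to [tail_add m q.+1], so that
the target degree of a zigzag does not change type along the recursion. *)
Fixpoint tail_add (m q : nat) : nat := if m is m'.+1 then tail_add m' q.+1 else q.

Lemma tail_addE m q : tail_add m q = (m + q)%N.
Proof. by elim: m q => //= m IH q; rewrite IH addnS addSn. Qed.

(** The staircase through the double complex from position [(m, q)] to the
edge [B]: lift along [dh], apply [dv], and repeat until the column 0 is
reached. From [eA u] in column [n] it relates the classes of [u] and of [v]. *)
Fixpoint zigzag (m q : nat) t : C m q t -> B (tail_add m q) t -> Prop :=
  match m return C m q t -> B (tail_add m q) t -> Prop with
  | 0 => fun z v => z = eB q t v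
  | m'.+1 => fun z v => exists w, dh m' q t w = z /\ zigzag (dv m' q t w) v
  end.

Lemma dh_dh p q t x : dh p.+1 q t (dh p q t x) = 0.
Proof. by apply/row; exists x. Qed.

Lemma dv_dv p q t x : dv p q.+1 t (dv p q t x) = 0.
Proof. by apply/col; exists x. Qed.

Lemma zigzag0 m q t : @zigzag m q t 0 0.
Proof.
elim: m q => [|m IH] q /=; first by rewrite ph0.
by exists 0; rewrite !ph0.
Qed.

Lemma zigzagP m q t c (z z' : C m q t) v v' :
  zigzag z v -> zigzag z' v' -> zigzag (c *: z + z') (c *: v + v').
Proof.
elim: m q z z' v v' => [|m IH] q z z' v v' /= => [-> ->|]; first by rewrite linearP.
case=> w [<- wv] [w' [<- wv']]; exists (c *: w + w').
by rewrite !linearP; split=> //; apply: IH.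
Qed.

Lemma zigzag_nat m q s t (h : (s <= t)%O) (z : C m q s) v :
  zigzag z v -> zigzag (pm_map (C m q) h z) (pm_map (B (tail_add m q)) h v).
Proof.
elim: m q z v => [|m IH] q z v /= => [->|]; first by rewrite ph_nat.
by case=> w [<- wv]; exists (pm_map _ h w); rewrite !ph_nat; split=> //; apply: IH.
Qed.

Lemma zigzag_total m q t (z : C m q t) :
  dh m q t z = 0 -> dv m q t z = 0 -> exists v, zigzag z v.
Proof.
elim: m q z => [|m IH] q z hz vz; first by have /row0[v <-] := hz; exists v.
have /row[w wz] := hz.
have [||v wv] := IH q.+1 (dv m q t w); last by exists v, w.
  by rewrite dhv wz vz.
exact: dv_dv.
Qed.

Lemma zigzag_cocycle m q t (z : C m q t) v :
  zigzag z v -> dv m q t z = 0 -> cc_d B _ t v = 0.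
Proof.
elim: m q z v => [|m IH] q z v /=.
  by move=> -> vv; apply: (@eB_mono q.+1 t); rewrite eBd vv ph0.
by case=> w [wz wv] vz; apply: IH wv _; exact: dv_dv.
Qed.

Lemma zigzag_onto m q t v : cc_d B (tail_add m q) t v = 0 ->
  exists z : C m q t, [/\ zigzag z v, dh m q t z = 0 & dv m q t z = 0].
Proof.
elim: m q v => [|m IH] q v /= dv0.
  exists (eB q t v); split=> //; last by rewrite -eBd dv0 ph0.
  by apply/row0; exists v.
have [z [zv hz vz]] := IH q.+1 v dv0.
have /col[w wz] := vz.
exists (dh m q t w); split; last 1 first.
- by rewrite -dhv wz.
- by exists w; rewrite wz.
- exact: dh_dh.
Qed.

(** The lift [w] used by the staircase and the given lift [x] differ by an
element that comes from the previous column; its preimage gives the primitive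
needed one step further. *)
Lemma zigzag_coboundaryr m q t (x : C m q t) v :
  zigzag (dh m q t x) v -> dv m q t x = 0 -> coboundary v.
Proof.
elim: m q x v => [|m IH] q x v /= [w [wx wv]] vx.
  have /row0[y yw] : dh 0 q t (w - x) = 0 by rewrite raddfB /= wx subrr.
  exists y; apply: (@eB_mono q.+1 t); rewrite -wv eBd yw raddfB /= vx subr0 //.
have /row[y yw] : dh m.+1 q t (w - x) = 0 by rewrite raddfB /= wx subrr.
apply: (IH q.+1 (dv m q t y)); last exact: dv_dv.
by rewrite dhv yw raddfB /= vx subr0.
Qed.

(** The primitive of [v] is carried back along the staircase: at every step it
corrects the lift [w] by an element that [dh] kills without changing [dv w]. *)
Lemma zigzag_coboundaryl m q t (w : C m q t) v :
  @zigzag m q.+1 t (dv m q t w) v -> coboundary v ->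
  exists x : C m q t, dv m q t x = dv m q t w /\ dh m q t x = 0.
Proof.
elim: m q w v => [|m IH] q w v /=.
  move=> wv [y yv]; exists (eB q t y); split; first by rewrite -eBd yv wv.
  by apply/row0; exists y.
case=> w' [w'w w'v] cv; have [x [xw' hx]] := IH _ _ _ w'v cv.
have /col[y yw'] : dv m q.+1 t (w' - x) = 0 by rewrite raddfB /= xw' subrr.
exists (dh m q t y); split; last exact: dh_dh.
by rewrite -dhv yw' raddfB /= hx subr0.
Qed.

Lemma zigzag_coboundary n t u (v : B (tail_add n 0) t) :
  zigzag (eA n t u) v -> coboundary u <-> coboundary v.
Proof.
case: n u v => [|i] u v /=.
  move=> uv; split=> [u0|v0].
    by apply: (@eB_mono 0 t); rewrite -uv u0 !ph0.
  by apply: (@eA_mono 0 t); rewrite uv v0 !ph0.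
move=> z; split=> [[w wu]|cv].
  apply: (@zigzag_coboundaryr i 0 t (eA i t w)); first by rewrite -eAd wu.
  by apply/col0; exists w.
case: z => w [wu wv]; have [x [xw hx]] := zigzag_coboundaryl wv cv.
have /col0[u' u'E] : dv i 0 t (w - x) = 0 by rewrite raddfB /= xw subrr.
exists u'; apply: (@eA_mono i.+1 t).
by rewrite eAd u'E raddfB /= hx subr0.
Qed.

(** The two edges of a double complex with exact rows and columns have the same
cohomology: the staircase relates classes on one edge with classes on the
other, and exactness makes this relation total and univalent both ways. *)
Lemma balance n : piso (cohomology A n) (cohomology B n).
Proof.
suff : piso (cohomology A n) (cohomology B (tail_add n 0)) by rewrite tail_addE addn0.
pose G t (x : cohomology A n t) (y : cohomology B (tail_add n 0) t) :=
  exists u v, [/\ represents x u, represents y v & zigzag (eA n t u) v].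
have vA t u : dv n 0 t (eA n t u) = 0 by apply/col0; exists u.
apply: (@piso_of_graph _ _ _ _ _ G).
- have [sA sB] := (represents_subgraph A n, represents_subgraph B (tail_add n 0)).
  split=> [t|t c x y x' y' [u [v [xu yv z]]] [u' [v' [xu' yv' z']]]|
           s t h x y [u [v [xu yv z]]]].
  + exists 0, 0; split; [exact: (sg0 sA)|exact: (sg0 sB)|rewrite ph0; exact: zigzag0].
  + exists (c *: u + u'), (c *: v + v').
    split; [exact: (sgP sA)|exact: (sgP sB)|rewrite linearP; exact: zigzagP].
  + exists (pm_map _ h u), (pm_map _ h v).
    split; [exact: (sg_nat sA)|exact: (sg_nat sB)|rewrite ph_nat; exact: zigzag_nat].
- move=> t y [u [v [x0 yv z]]]; apply/(represents_eq0 yv).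
  exact/(zigzag_coboundary z)/(represents_eq0 x0).
- move=> t x [u [v [xu y0 z]]]; apply/(represents_eq0 xu).
  exact/(zigzag_coboundary z)/(represents_eq0 y0).
- move=> t x; have [u xu] := representsT x.
  have hu : dh n 0 t (eA n t u) = 0 by rewrite -eAd (represents_cocycle xu) ph0.
  have [v zv] := zigzag_total hu (vA t u).
  have [y yv] := cocycle_represents (zigzag_cocycle zv (vA t u)).
  by exists y, u, v.
- move=> t y; have [v yv] := representsT y.
  have [z [zv hz vz]] := zigzag_onto (represents_cocycle yv).
  have /col0[u uz] := vz; subst z.
  have du : cc_d A n t u = 0 by apply: (@eA_mono n.+1 t); rewrite eAd hz ph0.
  have [x xu] := cocycle_represents du.
  by exists x, u, v.
Qed.

End Balance.

(** * Balance and vanishing of Ext *)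

Section Ext.
Variables (k : fieldType) (d : Order.disp_t) (Q : orderType d).
Variable phi : {omorphism (Q *p Q)%type -> Q}.
Implicit Types M N E : pmod k Q.

(** The flabbiness of the slices of an injective module gives the exact rows,
and projectivity the exact columns. *)
Lemma ext_balance M N (I : inj_resolution N) (P : proj_resolution M) n :
  piso (cohomology (ihom_proj phi N P) n) (cohomology (ihom_inj phi M I) n).
Proof.
have flI q t : flabby (pullback (slice phi t) (I q)).
  exact/flabby_pullback/injective_flabby/ir_injective.
apply: (@balance k d Q (ihom_proj phi N P) (ihom_inj phi M I)
  (fun p q => ihom phi (P p) (I q))
  (fun p q => ihom_map phi (pr_d P p) (phom_id (I q)))
  (fun p q => ihom_map phi (phom_id (P p)) (ir_d I q))
  (fun p => ihom_map phi (phom_id (P p)) (ir_aug I))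
  (fun q => ihom_map phi (pr_aug P) (phom_id (I q)))) => //.
- by move=> p q t x; exact: ihom_mapC.
- by move=> p t x; exact/esym/ihom_mapC.
- by move=> q t x; exact: ihom_mapC.
- move=> p; apply: ihom_monor; exact: ir_aug_mono.
- move=> q; apply: ihom_monol; exact: pr_aug_epi.
- move=> p; apply: ihom_exactr; [exact: pr_projective|exact: ir_aug_exact].
- move=> p q; apply: ihom_exactr; [exact: pr_projective|exact: ir_exact].
- move=> q; apply: ihom_exactl => //; exact: pr_aug_exact.
- move=> p q; apply: ihom_exactl => //; exact: pr_exact.
Qed.

Lemma is_ext_of_proj n M N E (P : proj_resolution M) :
  piso (cohomology (ihom_proj phi N P) n) E -> is_ext phi n M N E.
Proof.
move=> PE; have EI (I : inj_resolution N) : piso (cohomology (ihom_inj phi M I) n) E.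
  exact: piso_trans (piso_sym (ext_balance I P n)) PE.
split; [exact: enough_injectives|exact: EI|by constructor|].
move=> P'; have [I] := enough_injectives N.
exact: piso_trans (ext_balance I P' n) (EI I).
Qed.

Lemma is_ext_of_inj n M N E (I : inj_resolution N) :
  piso (cohomology (ihom_inj phi M I) n) E -> is_ext phi n M N E.
Proof.
move=> IE; have [P] := enough_projectives M.
exact/(@is_ext_of_proj _ _ _ _ P)/(piso_trans (ext_balance I P n)).
Qed.

End Ext.

Section Vanishing.
Variables (k : fieldType) (d : Order.disp_t) (Q : orderType d).
Variable phi : {omorphism (Q *p Q)%type -> Q}.
Implicit Types M N : pmod k Q.

Lemma pzero_eq0 t (x : pzero k Q t) : x = 0.
Proof. by apply/rowP => -[]. Qed.

Lemma pzero_projective : pprojective (pzero k Q).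
Proof.
move=> A B f g _; exists (phom_zero _ _) => t x /=.
by rewrite (pzero_eq0 x) !ph0.
Qed.

Lemma pzero_injective : pinjective (pzero k Q).
Proof.
move=> A B f g _; exists (phom_zero _ _) => t x /=.
by rewrite (pzero_eq0 (g t x)).
Qed.

Lemma cohomology_eq0 (C : cochain k Q) n t :
  (forall u : C n t, u = 0) -> forall x : cohomology C n t, x = 0.
Proof.
move=> C0 x; have [u xu] := representsT x; apply/(represents_eq0 xu).
by rewrite (C0 u); case: n {u xu x C0} => //= n; exists 0; rewrite ph0.
Qed.

Lemma ihom_pzerol N t (x : ihom phi (pzero k Q) N t) : x = 0.
Proof. by apply: ev_inj => s m; rewrite (pzero_eq0 m) !ph0. Qed.

Lemma ihom_pzeror M t (x : ihom phi M (pzero k Q) t) : x = 0.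
Proof. by apply: ev_inj => s m; exact: etrans (pzero_eq0 _) (esym (pzero_eq0 _)). Qed.

Definition stalk0 M (n : nat) : pmod k Q := if n is 0 then M else pzero k Q.

Definition self_proj_resolution M (prM : pprojective M) : proj_resolution M.
Proof.
apply: (@ProjResolution k d Q M (stalk0 M) (fun i => phom_zero _ _) (phom_id M)).
- by case=> //= n; exact: pzero_projective.
- by move=> t y; exists y.
- by move=> t y /=; split=> [->|[x <-]] //; exists 0.
- move=> i t y; split=> // _; exists 0; exact/esym/pzero_eq0.
Defined.

Definition self_inj_resolution M (injM : pinjective M) : inj_resolution M.
Proof.
apply: (@InjResolution k d Q M (stalk0 M) (fun i => phom_zero _ _) (phom_id M)).
- by case=> //= n; exact: pzero_injective.
- by move=> t x y.
- by move=> t y /=; split=> // _; exists y.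
- move=> i t y; split=> // _; exists 0; exact/esym/pzero_eq0.
Defined.

Lemma ext_projective M N n : pprojective M -> (1 <= n)%N ->
  is_ext phi n M N (pzero k Q).
Proof.
move=> prM n_gt0; apply: (@is_ext_of_proj _ _ _ _ _ _ _ _ (self_proj_resolution prM)).
apply/piso_pzero => t; apply: cohomology_eq0 => u.
by case: n n_gt0 u => // n _ u; exact: ihom_pzerol.
Qed.

Lemma ext_injective M N n : pinjective N -> (1 <= n)%N ->
  is_ext phi n M N (pzero k Q).
Proof.
move=> injN n_gt0; apply: (@is_ext_of_inj _ _ _ _ _ _ _ _ (self_inj_resolution injN)).
apply/piso_pzero => t; apply: cohomology_eq0 => u.
by case: n n_gt0 u => // n _ u; exact: ihom_pzeror.
Qed.

End Vanishing.

(** * Interval modules *)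

Section Intervals.
Variables (k : fieldType) (R : realType).
Implicit Types (s t : {nonneg R}) (N L : pmod k {nonneg R}).

(** The stalks of interval modules are [k] or 0 according to a boolean; the
coordinate is injective in both cases, so equations can be checked in [k]. *)
Definition kcoord (b : bool) : kfib k b -> k :=
  match b with true => id | false => fun _ => 0 end.

Definition kgen (b : bool) : kfib k b :=
  match b with true => 1 | false => 0 end.

Lemma kcoordP b c (x y : kfib k b) : kcoord (c *: x + y) = c * kcoord x + kcoord y.
Proof. by case: b x y => x y //=; rewrite mulr0 addr0. Qed.

Lemma kcoordZ b c (x : kfib k b) : kcoord (c *: x) = c * kcoord x.
Proof. by case: b x => x //=; rewrite mulr0. Qed.

Lemma kcoord0 b : kcoord (0 : kfib k b) = 0.
Proof. by case: b. Qed.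

Lemma kcoord_inj b : injective (@kcoord b).
Proof. by case: b => [x y //|x y _]; apply/rowP => -[]. Qed.

Lemma kcoord_out b (x : kfib k b) : ~~ b -> kcoord x = 0.
Proof. by case: b x. Qed.

Lemma kcoord_gen (b : bool) : b -> kcoord (kgen b) = 1.
Proof. by case: b. Qed.

Lemma kcoord_map (A : interval R) s t (h : (s <= t)%O) (x : kint k A s) :
  t%:num \in A -> kcoord (pm_map (kint k A) h x) = kcoord x.
Proof.
by rewrite /=; move: x => /=; case: (_ \in A) => x; case: (_ \in A).
Qed.

Section Ray.
Variable a : {nonneg R}.
Definition ray : pmod k {nonneg R} := kint k `[a%:num, +oo[.

Lemma in_ray t : (t%:num \in `[a%:num, +oo[) = (a <= t)%O.
Proof. by rewrite in_itv andbT. Qed.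

Definition ray_gen : ray a := kgen (a%:num \in `[a%:num, +oo[).

Lemma ray_out t (c : ray t) : ~ (a <= t)%O -> c = 0.
Proof.
move=> /negP nle_at; apply: kcoord_inj; rewrite kcoord0; apply: kcoord_out.
by rewrite in_ray.
Qed.

Lemma kcoord_ray_gen t : (a <= t)%O -> kcoord (ptr t ray_gen : ray t) = 1.
Proof. by move=> le_at; rewrite (ptrE le_at) kcoord_map ?in_ray // kcoord_gen ?in_ray. Qed.

Lemma ray_genE t (c : ray t) : kcoord c *: (ptr t ray_gen : ray t) = c.
Proof.
apply: kcoord_inj; rewrite kcoordZ; have [le_at|nle_at] := pselect (a <= t)%O.
  by rewrite kcoord_ray_gen // mulr1.
by rewrite (ray_out c nle_at) kcoord0 mul0r.
Qed.

(** Yoneda: the ray module at [a] is free on one generator in degree [a]. *)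
Lemma ray_hom L (x : L a) :
  exists f : phom ray L, forall t c, f t c = kcoord c *: ptr t x.
Proof.
pose f t (c : ray t) : L t := kcoord c *: ptr t x.
have flin t : linear (f t).
  by move=> e c c'; rewrite /f kcoordP scalerDl scalerA.
have fnat s t (h : (s <= t)%O) c : f t (pm_map ray h c) = pm_map L h (f s c).
  rewrite /f linearZZ; have [le_as|nle_as] := pselect (a <= s)%O.
    by rewrite pm_map_ptr // kcoord_map // in_ray (le_trans le_as h).
  by rewrite (ray_out c nle_as) !raddf0 !kcoord0 !scale0r.
by exists (PHom flin fnat).
Qed.

Lemma ray_hom_ext L (f g : phom ray L) : f a ray_gen = g a ray_gen ->
  forall t c, f t c = g t c.
Proof.
by move=> fg t c; rewrite -(ray_genE c) !linearZ /= !ph_ptr fg.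
Qed.

Lemma ray_projective : pprojective ray.
Proof.
move=> A B f g epif; have [x fx] := epif a (g a ray_gen).
have [h hE] := ray_hom x; exists h => t c.
by rewrite hE linearZ /= ph_ptr fx -ph_ptr -[RHS](congr1 (g t) (ray_genE c)) linearZ.
Qed.

End Ray.

(** A family over [J] has a nonzero member only at points [t < e]; such a
member extends down to [s] with the same coordinate, as [0, e[ is a down-set.
If no point of [J] lies below [e], the extension by 0 works. *)
Lemma flabby_initial (e : R) : flabby (kint k `[0, e[).
Proof.
move=> J s y JU Js yc.
have out t : ~ (t%:num < e) -> kcoord (y t) = 0.
  by move=> te; apply: kcoord_out; rewrite in_itv /= ge0; apply/negP.
have [[t0 [Jt0 t0e]]|no] := pselect (exists t, J t /\ t%:num < e); last first.
  exists 0 => t st Jt; rewrite raddf0; apply: kcoord_inj.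
  by rewrite kcoord0 out // => te; apply: no; exists t.
have se : s%:num \in `[0, e[.
  by rewrite in_itv /= ge0; apply: le_lt_trans t0e; exact: Js.
exists (kcoord (y t0) *: kgen (s%:num \in `[0, e[)) => t st Jt.
apply: kcoord_inj; have [te|te] := pselect (t%:num < e); last first.
  rewrite (out t te); apply: kcoord_out.
  by rewrite in_itv /= ge0; apply/negP.
have in0 (u : {nonneg R}) : u%:num < e -> u%:num \in `[0, e[ by rewrite in_itv /= ge0.
rewrite kcoord_map; last exact: in0.
rewrite kcoordZ kcoord_gen // mulr1.
case/orP: (le_total t t0) => [tt0|t0t].
  by rewrite -(yc _ _ tt0 Jt) kcoord_map //; exact: in0.
by rewrite -(yc _ _ t0t Jt0) kcoord_map //; exact: in0.
Qed.

Lemma kint_empty : piso (kint k `[0%R, 0%R[%R) (pzero k {nonneg R}).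
Proof.
apply: piso_pzero => t x; apply: kcoord_inj.
rewrite kcoord0 kcoord_out //; apply/negP; rewrite in_itv /= => /andP[t0].
by apply/negP; rewrite -leNgt.
Qed.

Section Resolution.
Variables (a b : {nonneg R}).
Hypothesis ab : a%:num < b%:num.

Let le_ab : (a <= b)%O := ltW ab.

Lemma ray_incl_exists : exists f : phom (ray b) (ray a),
  f b (ray_gen b) = ptr b (ray_gen a) /\ forall t c, kcoord (f t c) = kcoord c.
Proof.
have [f fE] := ray_hom (ptr b (ray_gen a) : ray a b).
exists f; split=> [|t c]; rewrite fE.
  by rewrite kcoord_gen ?in_ray // scale1r ptr_id.
rewrite kcoordZ; have [bt|nle_bt] := pselect (b <= t)%O.
  by rewrite (ptrE bt) pm_map_ptr // kcoord_ray_gen ?mulr1 // (le_trans le_ab bt).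
by rewrite (ray_out c nle_bt) kcoord0 mul0r.
Qed.

Definition ray_incl : phom (ray b) (ray a) := projT1 (cid ray_incl_exists).

Lemma ray_incl_gen : ray_incl b (ray_gen b) = ptr b (ray_gen a).
Proof. by rewrite /ray_incl; case: cid => f []. Qed.

Lemma ray_inclE t c : kcoord (ray_incl t c) = kcoord c.
Proof. by rewrite /ray_incl; case: cid => f []. Qed.

(** The resolution of the module of [a, b[ by the rays at [a] and at [b]. *)
Definition interval_obj (n : nat) : pmod k {nonneg R} :=
  match n with 0 => ray a | 1 => ray b | _ => pzero k {nonneg R} end.

Definition interval_d (n : nat) : phom (interval_obj n.+1) (interval_obj n) :=
  match n with 0 => ray_incl | _ => phom_zero _ _ end.

Local Notation kab := (kint k `[a%:num, b%:num[).

Lemma in_kab t : (t%:num \in `[a%:num, b%:num[) = (a <= t)%O && ~~ (b <= t)%O.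
Proof. by rewrite in_itv /= -ltNge. Qed.

Lemma interval_aug : exists f : phom (ray a) kab, forall t c,
  [/\ t%:num \in `[a%:num, b%:num[ -> kcoord (f t c) = kcoord c,
      t%:num \notin `[a%:num, b%:num[ -> f t c = 0 & 
      forall y : kab t, exists x, f t x = y].
Proof.
have aab : a%:num \in `[a%:num, b%:num[ by rewrite in_itv /= lexx ab.
have [f fE] := ray_hom (kgen (a%:num \in `[a%:num, b%:num[) : kab a).
have fin t c : t%:num \in `[a%:num, b%:num[ -> kcoord (f t c) = kcoord c.
  move=> tin; have le_at : (a <= t)%O by move: tin; rewrite in_kab => /andP[].
  by rewrite fE kcoordZ (ptrE le_at) kcoord_map // kcoord_gen // mulr1.
have fout t (y : kab t) : t%:num \notin `[a%:num, b%:num[ -> y = 0.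
  by move=> tout; apply: kcoord_inj; rewrite kcoord0 kcoord_out.
exists f => t c; split=> [|tout|y]; [exact: fin|exact: fout|].
have [tin|tout] := boolP (t%:num \in `[a%:num, b%:num[); last first.
  by exists 0; rewrite ph0 (fout t y).
exists (kcoord y *: ptr t (ray_gen a)); apply: kcoord_inj; rewrite fin //.
rewrite kcoordZ kcoord_ray_gen ?mulr1 //.
by move: tin; rewrite in_kab => /andP[].
Qed.

Definition interval_cover : phom (ray a) kab := projT1 (cid interval_aug).

Lemma interval_coverE t c : t%:num \in `[a%:num, b%:num[ ->
  kcoord (interval_cover t c) = kcoord c.
Proof. by rewrite /interval_cover; case: cid => f fP; case: (fP t c). Qed.

Lemma interval_cover_out t c : t%:num \notin `[a%:num, b%:num[ ->
  interval_cover t c = 0.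
Proof. by rewrite /interval_cover; case: cid => f fP; case: (fP t c). Qed.

Lemma interval_cover_epi : pepi interval_cover.
Proof. by rewrite /interval_cover; case: cid => f fP t y; case: (fP t 0). Qed.

Lemma interval_obj_projective n : pprojective (interval_obj n).
Proof. by case: n => [|[|n]] /=; [exact: ray_projective..|exact: pzero_projective]. Qed.

Lemma interval_exact0 : pexact (interval_d 0) interval_cover.
Proof.
move=> t y; split=> [fy|[x <-]]; last first.
  have [tin|tout] := boolP (t%:num \in `[a%:num, b%:num[).
    apply: kcoord_inj; rewrite interval_coverE // ray_inclE (ray_out x) ?kcoord0 //.
    by apply/negP; move: tin; rewrite in_kab => /andP[].
  exact: interval_cover_out.
have [bt|nle_bt] := pselect (b <= t)%O.
  exists (kcoord y *: ptr t (ray_gen b)); apply: kcoord_inj.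
  by rewrite ray_inclE kcoordZ kcoord_ray_gen // mulr1.
exists 0; rewrite ph0; have [le_at|nle_at] := pselect (a <= t)%O; last by rewrite (ray_out y).
have tin : t%:num \in `[a%:num, b%:num[ by rewrite in_kab le_at; apply/negP.
by apply: kcoord_inj; rewrite -(interval_coverE y tin) fy !kcoord0.
Qed.

Lemma interval_exactS n : pexact (interval_d n.+1) (interval_d n).
Proof.
case: n => [|i] t y; split=> [dy|[x <-]].
- exists 0; apply: kcoord_inj; rewrite kcoord0 -ray_inclE.
  by rewrite [X in kcoord X]dy kcoord0.
- exact: ph0.
- by exists 0; exact/esym/pzero_eq0.
- by [].
Qed.

Definition interval_resolution : proj_resolution kab :=
  ProjResolution interval_obj_projective interval_cover_epi interval_exact0
    interval_exactS.

Section Ext1.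
Variable phi : {omorphism ({nonneg R} *p {nonneg R})%type -> {nonneg R}}.
Variables c d : R.
Local Notation kcd := (kint k `[c, d[).

Lemma ext_interval_ge2 n : (2 <= n)%N -> is_ext phi n kab kcd (pzero k {nonneg R}).
Proof.
move=> n_ge2; apply: (@is_ext_of_proj _ _ _ _ _ _ _ _ interval_resolution).
apply/piso_pzero => t; apply: cohomology_eq0 => u.
by case: n n_ge2 u => [|[|n]] // _ u; exact: ihom_pzerol.
Qed.

Variable A : interval R.
Hypothesis inA : forall t, (t%:num \in A) =
  ((slice phi t b)%:num \in `[c, d[) && ((slice phi t a)%:num \notin `[c, d[).

(** By Yoneda a 1-cochain at [t] is an element of the module of [c, d[ at
[phi (b, t)], and the coboundaries are the elements that come from
[phi (a, t)]. So the class is nonzero only if [phi (b, t)] lies in [c, d[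
and [phi (a, t)] does not, and then it is determined by a coordinate. *)
Lemma cohomology_interval1 :
  piso (cohomology (ihom_proj phi kcd interval_resolution) 1) (kint k A).
Proof.
set C := ihom_proj phi kcd interval_resolution.
pose val_b t (u : C 1 t) : k := kcoord (ev u b (ray_gen b)).
have val_bP t e u v : @val_b t (e *: u + v) = e * val_b t u + val_b t v.
  by rewrite /val_b evP [LHS]kcoordP.
have val_b_inj t u v : val_b t u = val_b t v -> u = v.
  move=> uv; apply: ev_inj; apply: ray_hom_ext; exact: kcoord_inj.
(* Restriction in [t] keeps the coordinate where the target stalk is nonzero. *)
have val_b_res s t (h : (s <= t)%O) u : t%:num \in A ->
    val_b t (pm_map (C 1) h u) = val_b s u.
  rewrite inA => /andP[bin _]; rewrite /val_b (ev_res _ _ (slice_le phi b h)).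
  exact: kcoord_map.
(* A coboundary is the image of an element of the stalk at [phi (a, t)]. *)
have val_b_d t (w : C 0 t) : val_b t (cc_d C 0 t w) =
    kcoord (pm_map kcd (omorph_le (slice phi t) le_ab) (ev w a (ray_gen a))).
  have -> : val_b t (cc_d C 0 t w) = kcoord (ev w b (ray_incl b (ray_gen b))) by [].
  by rewrite ray_incl_gen ph_ptr (ptrE le_ab).
have val_b_onto t (u : C 1 t) : t%:num \notin A -> exists w, cc_d C 0 t w = u.
  rewrite inA negb_and negbK => tA.
  have [bin|bout] := boolP ((slice phi t b)%:num \in `[c, d[); last first.
    exists 0; rewrite ph0; apply: val_b_inj.
    by rewrite [LHS]kcoord_out // [RHS]kcoord_out.
  rewrite bin /= in tA.
  have [f fE] := ray_hom (val_b t u *: kgen ((slice phi t a)%:num \in `[c, d[) :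
    pullback (slice phi t) kcd a).
  have [w wE] := ev_surj f; exists w; apply: val_b_inj.
  rewrite val_b_d kcoord_map // wE fE ptr_id kcoord_gen ?in_ray // scale1r.
  by rewrite [LHS]kcoordZ kcoord_gen // mulr1.
have val_b_surj t e : t%:num \in A -> exists u : C 1 t, val_b t u = e.
  rewrite inA => /andP[bin _].
  have [f fE] := ray_hom (e *: kgen ((slice phi t b)%:num \in `[c, d[) :
    pullback (slice phi t) kcd b).
  have [u uE] := ev_surj f; exists u.
  rewrite /val_b uE fE ptr_id kcoord_gen ?in_ray // scale1r.
  by rewrite [LHS]kcoordZ kcoord_gen // mulr1.
pose G t (x : cohomology C 1 t) (e : kint k A t) :=
  exists u, represents x u /\ (t%:num \in A -> val_b t u = kcoord e).
have sC := represents_subgraph C 1.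
apply: (@piso_of_graph _ _ _ _ _ G).
- split=> [t|t l x e x' e' [u [xu ue]] [u' [xu' ue']]|s t h x e [u [xu ue]]].
  + exists 0; split; first exact: (sg0 sC).
    by move=> _; rewrite kcoord0 /val_b; apply: kcoord0.
  + exists (l *: u + u'); split; first exact: (sgP sC).
    by move=> tA; rewrite val_bP kcoordP ue // ue'.
  + exists (pm_map _ h u); split; first exact: (sg_nat sC).
    move=> tA; rewrite val_b_res // kcoord_map //.
    have [sA|/negP sA] := pselect (s%:num \in A); first exact: ue.
    (* The interval does not contain [s], so the coordinate of [u] has to vanish.
       It does, because [phi (b, s)] is outside [c, d[: otherwise [phi (a, s)]
       would be in [c, d[, hence also [phi (a, t)], against [t] in [A]. *)
    have sta : (slice phi s a)%:num <= (slice phi t a)%:num := slice_le phi a h.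
    have tab : (slice phi t a)%:num <= (slice phi t b)%:num :=
      omorph_le (slice phi t) le_ab.
    have -> : kcoord e = 0 by apply: kcoord_out.
    apply: kcoord_out; apply: contra sA => sb.
    move: sb tA; rewrite !inA => sb; rewrite sb /=.
    move: sb; rewrite !in_itv /= => /andP[_ _] /andP[/andP[_ tbd]].
    rewrite !negb_and -!ltNge -!leNgt => /orP[tac|dta].
      by rewrite (le_lt_trans sta tac).
    by have := le_lt_trans (le_trans dta tab) tbd; rewrite ltxx.
- move=> t e [u [xu ue]].
  have /(represents_eq0 xu)[w wu] : (0 : cohomology C 1 t) = 0 by [].
  apply: kcoord_inj; rewrite kcoord0.
  have [tA|/negP tA] := pselect (t%:num \in A); last exact: kcoord_out.
  rewrite -ue // -wu val_b_d.
  have a0 : ev w a (ray_gen a) = 0.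
    apply: kcoord_inj; rewrite [RHS]kcoord0; apply: kcoord_out.
    by move: tA; rewrite inA => /andP[].
  by rewrite [X in pm_map _ _ X]a0 raddf0; apply: kcoord0.
- move=> t x [u [xu ue]]; apply/(represents_eq0 xu).
  have [tA|/negP tA] := pselect (t%:num \in A); last exact: val_b_onto.
  exists 0; rewrite ph0; apply: val_b_inj.
  by rewrite ue // kcoord0; apply: kcoord0.
- move=> t x; have [u xu] := representsT x.
  exists (val_b t u *: kgen (t%:num \in A)), u; split=> // tA.
  by rewrite kcoordZ kcoord_gen // mulr1.
- move=> t e.
  have [tA|/negP tA] := pselect (t%:num \in A); last first.
    by exists 0, 0; split=> [|tA']; [exact: (sg0 sC)|rewrite tA' in tA].
  have [u ue] := val_b_surj t (kcoord e) tA.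
  have [x xu] : exists x, @represents _ _ _ C 1 t x u.
    by apply: cocycle_represents; exact: ihom_pzerol.
  by exists x, u.
Qed.

End Ext1.

End Resolution.

End Intervals.

(** * The intervals for the power costs and the maximum cost *)

Section Costs.
Variable R : realType.
Implicit Types p u t z : R.

Lemma in_co (x l r : R) : (x \in `[l, r[) = (l <= x) && (x < r).
Proof. by rewrite in_itv. Qed.

Lemma powR_le p u v : 0 < p -> 0 <= u -> 0 <= v -> (u `^ p <= v `^ p) = (u <= v).
Proof.
move=> p0 u0 v0; apply/idP/idP => [|uv].
  by apply: contraTT; rewrite -!ltNge => vu; apply: gt0_ltr_powR.
by apply: ge0_ler_powR => //; exact: ltW.
Qed.

Lemma powRK p u : 0 < p -> 0 <= u -> (u `^ p) `^ p^-1 = u.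
Proof. by move=> p0 u0; rewrite -powRrM divff ?gt_eqF // powRr1. Qed.

Lemma powR_inv_le p u t : 0 < p -> 0 <= u -> 0 <= t ->
  (u `^ p^-1 <= t) = (u <= t `^ p).
Proof.
by move=> p0 u0 t0; rewrite -{1}(powRK p0 t0) powR_le ?invr_gt0 ?powR_ge0.
Qed.

Lemma le_powR_inv p u z : 0 < p -> 0 <= u -> 0 <= z ->
  (z <= u `^ p^-1) = (z `^ p <= u).
Proof.
by move=> p0 u0 z0; rewrite -{1}(powRK p0 z0) powR_le ?invr_gt0 ?powR_ge0.
Qed.

(** The lower end of the interval solves [z <= phi (x, t)] for [t]; the maximum
with 0 covers the case where every [t] is a solution. *)
Lemma le_powR_sum p x t z : 0 < p -> 0 <= t -> 0 <= z ->
  (Num.max 0 (z `^ p - x `^ p) `^ p^-1 <= t) = (z <= (x `^ p + t `^ p) `^ p^-1).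
Proof.
move=> p0 t0 z0.
have m0 : 0 <= Num.max 0 (z `^ p - x `^ p) by rewrite le_max lexx.
have s0 : 0 <= x `^ p + t `^ p by rewrite addr_ge0 // powR_ge0.
by rewrite (powR_inv_le p0 m0 t0) (le_powR_inv p0 s0 z0) ge_max powR_ge0 lerBlDl.
Qed.

Lemma in_co_min (t l l' r c d u v : R) :
    (l <= t) = (c <= v) -> (l' <= t) = (c <= u) -> (r <= t) = (d <= v) -> u <= v ->
  (t \in `[l, Num.min l' r[) = (v \in `[c, d[) && (u \notin `[c, d[).
Proof.
move=> lE l'E rE uv; rewrite !in_co lt_min lE !(ltNge t) l'E rE.
have [cv|] //= := leP c v.
have [dv|vd] //= := leP d v; first by rewrite andbF.
by rewrite (le_lt_trans uv vd) !andbT.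
Qed.

Lemma in_interval_powR p (a b c d t : R) : 0 < p -> 0 <= a -> a <= b ->
    0 <= c -> 0 <= d -> 0 <= t ->
  (t \in `[(Num.max 0 (c `^ p - b `^ p)) `^ p^-1,
      Num.min ((Num.max 0 (c `^ p - a `^ p)) `^ p^-1)
              ((Num.max 0 (d `^ p - b `^ p)) `^ p^-1)[) =
  ((b `^ p + t `^ p) `^ p^-1 \in `[c, d[) &&
  ((a `^ p + t `^ p) `^ p^-1 \notin `[c, d[).
Proof.
move=> p0 a0 ab c0 d0 t0.
apply: in_co_min; [exact: le_powR_sum..|].
apply: ge0_ler_powR; rewrite ?invr_ge0 ?nnegrE ?addr_ge0 ?powR_ge0 ?(ltW p0) //.
by rewrite lerD2r ge0_ler_powR ?nnegrE ?(ltW p0) // (le_trans a0 ab).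
Qed.

(** If [c <= t] and the maximum of [b] and [t] is below [d], then the maximum of
[a] and [t] is in [c, d[ too; so only the values [t < c] can occur, and for them
both maxima compare with [c] as [a] and [b] do. *)
Lemma in_interval_max (a b c d t : R) : a <= b -> 0 <= t -> c < d ->
  (t \in `[0, if [&& a < c, c <= b & b < d] then c else 0[) =
  (Num.max b t \in `[c, d[) && (Num.max a t \notin `[c, d[).
Proof.
move=> ab t0 cd; rewrite !in_co t0 !le_max !gt_max /=.
have [ct|tc] := leP c t.
  have -> : (t < if [&& a < c, c <= b & b < d] then c else 0) = false.
    by apply/negbTE; rewrite -leNgt; case: ifP.
  rewrite !orbT /=; have [bd|db] := ltP b d => //=.
  by rewrite (le_lt_trans ab bd); case: (t < d).
rewrite (lt_trans tc cd) !orbF !andbT.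
have [cb|bc] := leP c b; last by rewrite /= andbF ltNge t0.
have [bd|db] := ltP b d; last by rewrite /= ?andbF ltNge t0.
rewrite (le_lt_trans ab bd) !andbT -ltNge /=.
by case: ifP => // _; rewrite ?tc // ltNge t0.
Qed.

End Costs.

Lemma num_slice_max (R : realType) (y_gt0 : (0 < +oo :> \bar R)%E) (t x : {nonneg R}) :
  (slice (lp_cost y_gt0) t x)%:num = Num.max x%:num t%:num.
Proof.
change ((Order.max x t)%:num = Num.max x%:num t%:num).
by rewrite /Order.max num_lt; case: ifP.
Qed.

Theorem proposition4p31 (k : fieldType) (R : realType) (a b c d : R)
    (a_ge0 : 0 <= a) (a_lt_b : a < b) (c_ge0 : 0 <= c) (c_lt_d : c < d) :
  [/\ (forall (p : R) (p_gt0 : (0 < p%:E)%E),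
        is_ext (lp_cost p_gt0) 1 (kint k `[a, b[) (kint k `[c, d[)
          (kint k `[ (Num.max 0 (c `^ p - b `^ p)) `^ p^-1,
                     Num.min ((Num.max 0 (c `^ p - a `^ p)) `^ p^-1)
                             ((Num.max 0 (d `^ p - b `^ p)) `^ p^-1) [) /\
        (forall i : nat, (2 <= i)%N ->
          is_ext (lp_cost p_gt0) i (kint k `[a, b[) (kint k `[c, d[)
            (pzero k {nonneg R}))),
      (forall y_gt0 : (0 < +oo :> \bar R)%E,
        is_ext (lp_cost y_gt0) 1 (kint k `[a, b[) (kint k `[c, d[)
          (if [&& a < c, c <= b & b < d] then kint k `[0, c[
           else pzero k {nonneg R}) /\
        (forall i : nat, (2 <= i)%N ->
          is_ext (lp_cost y_gt0) i (kint k `[a, b[) (kint k `[c, d[)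
            (pzero k {nonneg R}))),
      (forall (p : \bar R) (p_gt0 : (0 < p)%E) (i : nat)
          (M : pmod k {nonneg R}), (1 <= i)%N ->
        is_ext (lp_cost p_gt0) i (kint k `[a, +oo[) M (pzero k {nonneg R})) &
      (forall (p : \bar R) (p_gt0 : (0 < p)%E) (i : nat)
          (M : pmod k {nonneg R}), (1 <= i)%N ->
        is_ext (lp_cost p_gt0) i M (kint k `[0, d[) (pzero k {nonneg R}))].
Proof.
pose a' : {nonneg R} := NngNum a_ge0.
pose b' : {nonneg R} := NngNum (ltW (le_lt_trans a_ge0 a_lt_b)).
have ab' : a'%:num < b'%:num by [].
have d_ge0 : 0 <= d := ltW (le_lt_trans c_ge0 c_lt_d).
split.
- move=> p p_gt0; have p_gt0' : 0 < p by rewrite -lte_fin.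
  split; last by move=> i i2; exact: (ext_interval_ge2 k ab' (lp_cost p_gt0) c d i2).
  apply: (is_ext_of_proj (P := interval_resolution k ab')).
  apply: cohomology_interval1 => t.
  exact: (in_interval_powR p_gt0' a_ge0 (ltW a_lt_b) c_ge0 d_ge0 (ge0 t)).
- move=> y_gt0.
  split; last by move=> i i2; exact: (ext_interval_ge2 k ab' (lp_cost y_gt0) c d i2).
  apply: (is_ext_of_proj (P := interval_resolution k ab')).
  (* Outside of the stated case the interval computed in degree 1 is empty; it
     is written [0, 0[ so that both cases are instances of one computation. *)
  have H : piso (cohomology (ihom_proj (lp_cost y_gt0) (kint k `[c, d[)
     (interval_resolution k ab')) 1)
     (kint k `[0, if [&& a < c, c <= b & b < d] then c else 0[).
    apply: cohomology_interval1 => t.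
    by rewrite (in_interval_max (ltW a_lt_b) (ge0 t) c_lt_d) !num_slice_max.
  case: ifP H => // _ H; exact: piso_trans H (kint_empty k R).
- move=> p p_gt0 i M i1.
  exact: (ext_projective (lp_cost p_gt0) M (ray_projective (a := a')) i1).
- move=> p p_gt0 i M i1.
  exact: (ext_injective (lp_cost p_gt0) M (flabby_injective (flabby_initial (e := d))) i1).
Qed.
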